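(* Let $f:\mathbb{B}\to\mathbb{B}$ be a slice regular function and suppose that $f$ has a fixed point $q_0\in\mathbb{B}$. Then either $f$ is the identity function, or $f$ has no other fixed point in $\mathbb{B}$.
   Context: $\mathbb{H}$ denotes the quaternions, $\mathbb{B}=\{q\in\mathbb{H}: |q|<1\}$, $\mathbb{S}=\{q\in\mathbb{H}: q^2=-1\}$, $L_I=\mathbb{R}+I\mathbb{R}$ for $I\in\mathbb{S}$. A function $f:\Omega\to\mathbb{H}$ on a domain $\Omega\subseteq\mathbb{H}$ is slice regular if for every $I\in\mathbb{S}$ its restriction to $\Omega\cap L_I$ is real differentiable and $\frac12\left(\frac{\partial}{\partial x}+I\frac{\partial}{\partial y}\right)f(x+Iy)=0$ there. On $\mathbb{B}$ the slice regular functions are exactly the power series $f(q)=\sum_n q^na_n$, $a_n\in\mathbb{H}$, converging in $\mathbb{B}$. *)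

(* Defs.v *)
From HB Require Import structures.
From mathcomp Require Import all_boot all_order all_algebra.
From mathcomp Require Import ring lra.
From mathcomp Require Import all_classical all_reals all_analysis.
Set Implicit Arguments. Unset Strict Implicit. Unset Printing Implicit Defensive.
Import Order.TTheory GRing.Theory Num.Theory.
Import numFieldNormedType.Exports.
Local Open Scope classical_set_scope.
Local Open Scope ring_scope.

(* [Quat a b c d] is a + b i + c j + d k. *)
Record quat (R : Type) : Type := Quat { qre : R; qi : R; qj : R; qk : R }.

Definition quat_tuple (R : Type) (q : quat R) : R * R * R * R :=
  (qre q, qi q, qj q, qk q).

Definition tuple_quat (R : Type) (t : R * R * R * R) : quat R :=
  Quat t.1.1.1 t.1.1.2 t.1.2 t.2.

Lemma quat_tupleK (R : Type) : cancel (@quat_tuple R) (@tuple_quat R).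
Proof. by case. Qed.

HB.instance Definition _ (R : realType) :=
  Choice.copy (quat R) (can_type (@quat_tupleK R)).

Section QuatAlgebra.
Variable R : realType.
Implicit Types (p q r : quat R) (a : R).

Definition quat_add p q :=
  Quat (qre p + qre q) (qi p + qi q) (qj p + qj q) (qk p + qk q).

Definition quat_opp q := Quat (- qre q) (- qi q) (- qj q) (- qk q).

Definition quat_mul p q := Quat
  (qre p * qre q - qi p * qi q - qj p * qj q - qk p * qk q)
  (qre p * qi q + qi p * qre q + qj p * qk q - qk p * qj q)
  (qre p * qj q - qi p * qk q + qj p * qre q + qk p * qi q)
  (qre p * qk q + qi p * qj q - qj p * qi q + qk p * qre q).

Definition quat_scale a q := Quat (a * qre q) (a * qi q) (a * qj q) (a * qk q).

Lemma quat_addA : associative quat_add.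
Proof. by move=> p q r; rewrite /quat_add /= !addrA. Qed.

Lemma quat_addC : commutative quat_add.
Proof. by move=> p q; congr Quat; rewrite /= addrC. Qed.

Lemma quat_add0 : left_id (Quat 0 0 0 0) quat_add.
Proof. by case=> a b c d; rewrite /quat_add /= !add0r. Qed.

Lemma quat_addN : left_inverse (Quat 0 0 0 0) quat_opp quat_add.
Proof. by move=> q; rewrite /quat_add /= !addNr. Qed.

HB.instance Definition _ :=
  GRing.isZmodule.Build (quat R) quat_addA quat_addC quat_add0 quat_addN.

Lemma quat_mulA : associative quat_mul.
Proof. by move=> p q r; congr Quat => /=; ring. Qed.

Lemma quat_mul1q : left_id (Quat 1 0 0 0) quat_mul.
Proof. by case=> a b c d; congr Quat => /=; ring. Qed.

Lemma quat_mulq1 : right_id (Quat 1 0 0 0) quat_mul.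
Proof. by case=> a b c d; congr Quat => /=; ring. Qed.

Lemma quat_mulDl : left_distributive quat_mul (@GRing.add (quat R)).
Proof. by move=> p q r; congr Quat => /=; ring. Qed.

Lemma quat_mulDr : right_distributive quat_mul (@GRing.add (quat R)).
Proof. by move=> p q r; congr Quat => /=; ring. Qed.

Lemma quat_oner_neq0 : Quat 1 0 0 0 != 0 :> quat R.
Proof. by apply/eqP => -[] /eqP; rewrite oner_eq0. Qed.

HB.instance Definition _ :=
  GRing.Zmodule_isNzRing.Build (quat R) quat_mulA
    quat_mul1q quat_mulq1 quat_mulDl quat_mulDr
    quat_oner_neq0.

Lemma quat_scaleA a b q : quat_scale a (quat_scale b q) = quat_scale (a * b) q.
Proof. by congr Quat => /=; ring. Qed.

Lemma quat_scale1 : left_id 1 quat_scale.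
Proof. by case=> a b c d; congr Quat => /=; ring. Qed.

Lemma quat_scaleDr : right_distributive quat_scale +%R.
Proof. by move=> a p q; congr Quat => /=; ring. Qed.

Lemma quat_scaleDl q : {morph quat_scale^~ q : a b / a + b}.
Proof. by move=> a b; congr Quat => /=; ring. Qed.

HB.instance Definition _ := GRing.Zmodule_isLmodule.Build R (quat R)
  quat_scaleA quat_scale1 quat_scaleDr quat_scaleDl.

Lemma quat_scaleAl a p q : a *: (p * q) = (a *: p) * q.
Proof. by congr Quat => /=; ring. Qed.

Lemma quat_scaleAr a p q : a *: (p * q) = p * (a *: q).
Proof. by congr Quat => /=; ring. Qed.

HB.instance Definition _ :=
  GRing.Lmodule_isLalgebra.Build R (quat R) quat_scaleAl.
HB.instance Definition _ :=
  GRing.Lalgebra_isAlgebra.Build R (quat R) quat_scaleAr.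

Definition quat_norm q : R :=
  Num.sqrt (qre q ^+ 2 + qi q ^+ 2 + qj q ^+ 2 + qk q ^+ 2).

Lemma quat_normD p q : quat_norm (p + q) <= quat_norm p + quat_norm q.
Proof.
case: p q => a b c d [e f g h]; rewrite /quat_norm /=.
set A := a ^+ 2 + _ + _ + _; set B := e ^+ 2 + _ + _ + _.
have A0 : 0 <= A by rewrite !addr_ge0 ?sqr_ge0.
have B0 : 0 <= B by rewrite !addr_ge0 ?sqr_ge0.
have CS : a * e + b * f + c * g + d * h <= Num.sqrt A * Num.sqrt B.
  rewrite -sqrtrM //; apply: (le_trans (ler_norm _)).
  rewrite -sqrtr_sqr ler_wsqrtr // -subr_ge0.
  rewrite [X in 0 <= X](_ : _ =
      (a * f - b * e) ^+ 2 + (a * g - c * e) ^+ 2 + (a * h - d * e) ^+ 2 +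
      (b * g - c * f) ^+ 2 + (b * h - d * f) ^+ 2 + (c * h - d * g) ^+ 2).
    by rewrite !addr_ge0 ?sqr_ge0.
  by rewrite /A /B; ring.
rewrite -[leRHS]ger0_norm ?addr_ge0 ?sqrtr_ge0 // -sqrtr_sqr.
rewrite ler_wsqrtr // [leRHS]sqrrD !sqr_sqrtr //.
by move: CS; rewrite -mulr_natl /A /B; nra.
Qed.

Lemma quat_normZ a q : quat_norm (a *: q) = `|a| * quat_norm q.
Proof.
rewrite /quat_norm -sqrtr_sqr -sqrtrM ?sqr_ge0 //=.
by congr Num.sqrt; ring.
Qed.

Lemma quat_norm0_eq0 q : quat_norm q = 0 -> q = 0.
Proof.
case: q => a b c d; rewrite /quat_norm /= => /eqP; rewrite sqrtr_eq0.
move=> le0; have : a ^+ 2 + b ^+ 2 + c ^+ 2 + d ^+ 2 == 0.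
  by rewrite eq_le le0 !addr_ge0 ?sqr_ge0.
rewrite !paddr_eq0 ?addr_ge0 ?sqr_ge0 // !sqrf_eq0.
by move=> /andP[/andP[/andP[/eqP-> /eqP->] /eqP->] /eqP->].
Qed.

HB.instance Definition _ :=
  Lmodule_isNormed.Build R (quat R) quat_normD quat_normZ quat_norm0_eq0.

End QuatAlgebra.

Definition unit_ball (R : realType) : set (quat R) := [set q | `|q| < 1].
Arguments unit_ball : clear implicits.

Definition imag_units (R : realType) : set (quat R) := [set q | q ^+ 2 = -1].
Arguments imag_units : clear implicits.

(* The point x + Iy of the slice L_I, in its real coordinates (x, y). *)
Definition slice_pt (R : realType) (I : quat R) (p : R * R) : quat R :=
  (p.1)%:A + p.2 *: I.

(* Slice regularity on an open set D. [f] is total, but since D is open the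
   condition only involves the values of [f] on D. *)
Definition slice_regular (R : realType) (D : set (quat R))
    (f : quat R -> quat R) : Prop :=
  forall I, imag_units R I ->
  forall x y : R, D (slice_pt I (x, y)) ->
    let fI := f \o slice_pt I in
    differentiable fI (x, y) /\
    2^-1 *: ('D_(1, 0) fI (x, y) + I * 'D_(0, 1) fI (x, y)) = 0.

(* Main.v *)
(* On each slice L_I the function f is complex differentiable, so Goursat's argument gives
   Cauchy's theorem and a power series f(q) = sum_n q^n a_n, whose coefficients do not
   depend on I because they are determined on the real axis. The representation formula
   f(x + yI) = b + I c and |f| <= 1 show that the regular product g = f * h of f with a
   polynomial h satisfies |g(z)|^2 + |g(z')|^2 <= |h(z)|^2 + |h(z')|^2 at conjugate points
   z, z' of a slice; averaging over circles, convolution with (a_n) is a contraction of l^2.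
   If q0 and q1 are two fixed points, set u_n = conj (q0^n - q1^n) and h_m = u_(m+1).
   The fixed point equations give <u, a * h> = |h|^2 = |u|^2, hence
   |a * h - u|^2 <= |h|^2 - 2 |h|^2 + |u|^2 = 0. Thus a * h = u is the shift of h, and since
   h_0 != 0 this forces a_n = 0 for n != 1 and a_1 = 1, that is f(q) = q. *)
Require Import Defs.
From mathcomp Require Import all_boot all_order all_algebra.
From mathcomp Require Import ring lra.
From mathcomp Require Import all_classical all_reals all_analysis.
Import Order.TTheory GRing.Theory Num.Theory.
Import numFieldNormedType.Exports.
Set Implicit Arguments. Unset Strict Implicit. Unset Printing Implicit Defensive.
Local Open Scope classical_set_scope.
Local Open Scope ring_scope.

(** The obstacle is that [f] does not map a slice into itself. In the regular product the powers of
    the variable stand to the left of the values of [f], so it is not the pointwise product, and |f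
    * h| <= |h| fails at single points already for a constant [f], for instance 9/10 times the unit
    j. Only the sum over two conjugate points obeys such a bound. The sequence conj (q0^n) is the
    reproducing kernel at q0 of the space of square summable power series. Where f(q) is not 0, the
    regular product takes the value f(q) h(f(q)^-1 q f(q)); at a fixed point the conjugation is
    trivial and this is q h(q). So, tested against the kernels of the two fixed points,
    multiplication by [f] looks like the shift. Taking the difference of the kernels removes the
    constant term, u_0 = 0, so u is itself a shift, that of h; u and h then have the same norm, and
    the contraction leaves no room between a * h and u. No Moebius map has to carry q0 to the
    origin. *)

Section QuaternionNorm.
Variable R : realType.
Implicit Types (p q : quat R) (a : R).

Definition qconj q : quat R := Quat (qre q) (- qi q) (- qj q) (- qk q).
Definition qdot p q : R :=
  qre p * qre q + qi p * qi q + qj p * qj q + qk p * qk q.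
(** Takes the value 0 at 0, so that [qnorm_inv] holds without a side condition. *)
Definition qinv q : quat R := `|q| ^- 2 *: qconj q.

Lemma quat_ext p q :
  qre p = qre q -> qi p = qi q -> qj p = qj q -> qk p = qk q -> p = q.
Proof. by case: p => ? ? ? ?; case: q => ? ? ? ? /= -> -> -> ->. Qed.

Lemma quat_addE p q : p + q = quat_add p q. Proof. by []. Qed.
Lemma quat_oppE p : - p = quat_opp p. Proof. by []. Qed.
Lemma quat_mulE p q : p * q = quat_mul p q. Proof. by []. Qed.
Lemma quat_scaleE a p : a *: p = quat_scale a p. Proof. by []. Qed.
Lemma quat_oneE : 1 = Quat 1 0 0 0 :> quat R. Proof. by []. Qed.
Lemma quat_zeroE : 0 = Quat 0 0 0 0 :> quat R. Proof. by []. Qed.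

(** After [quat_ext], rewriting with this list turns a quaternion identity into four real ones for
    [ring]. *)
Definition quatE :=
  (quat_addE, quat_oppE, quat_mulE, quat_scaleE, quat_oneE, quat_zeroE).

Lemma qnorm2 q : `|q| ^+ 2 = qdot q q.
Proof.
by rewrite [`|q|]/(quat_norm q) sqr_sqrtr ?addr_ge0 ?sqr_ge0.
Qed.

Lemma qnormM p q : `|p * q| = `|p| * `|q|.
Proof.
apply/eqP; rewrite -(@eqrXn2 _ 2) ?mulr_ge0 //; apply/eqP.
by rewrite exprMn !qnorm2 /qdot !quatE /=; ring.
Qed.

Lemma qnorm1 : `|1 : quat R| = 1.
Proof.
apply/eqP; rewrite -(@eqrXn2 _ 2) //; apply/eqP.
by rewrite qnorm2 /qdot /=; ring.
Qed.

Lemma qnormX q n : `|q ^+ n| = `|q| ^+ n.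
Proof. by elim: n => [|n IH]; rewrite ?expr0 ?qnorm1 // !exprS qnormM IH. Qed.

Lemma mul_qconj q : q * qconj q = (`|q| ^+ 2)%:A.
Proof. by rewrite qnorm2; apply: quat_ext; rewrite /qdot !quatE /=; ring. Qed.

Lemma mul_qinv q : q != 0 -> q * qinv q = 1.
Proof.
move=> q0; rewrite /qinv -scalerAr mul_qconj scalerA mulVf ?scale1r //.
by rewrite expf_neq0 // normr_eq0.
Qed.

Lemma mul_qVq q : q != 0 -> qinv q * q = 1.
Proof.
move=> q0; rewrite /qinv -scalerAl.
have -> : qconj q * q = q * qconj q.
  by apply: quat_ext; rewrite !quatE /=; ring.
rewrite mul_qconj scalerA mulVf ?scale1r //.
by rewrite expf_neq0 // normr_eq0.
Qed.

Lemma qnorm_conj q : `|qconj q| = `|q|.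
Proof.
apply/eqP; rewrite -(@eqrXn2 _ 2) //; apply/eqP.
by rewrite !qnorm2 /qdot /=; ring.
Qed.

Lemma qnorm_inv q : `|qinv q| = `|q|^-1.
Proof.
rewrite /qinv normrZ qnorm_conj ger0_norm ?invr_ge0 ?sqr_ge0 //.
have [->|q0] := eqVneq q 0; first by rewrite normr0 mulr0 invr0.
by rewrite expr2 invfM -mulrA mulVf ?mulr1 // normr_eq0.
Qed.

Lemma qre_le q : `|qre q| <= `|q|.
Proof.
rewrite -(@ler_pXn2r _ 2) ?nnegrE // real_normK ?num_real // qnorm2 /qdot.
by move: (sqr_ge0 (qi q)) (sqr_ge0 (qj q)) (sqr_ge0 (qk q)); rewrite !expr2; lra.
Qed.
Lemma qi_le q : `|qi q| <= `|q|.
Proof.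
rewrite -(@ler_pXn2r _ 2) ?nnegrE // real_normK ?num_real // qnorm2 /qdot.
by move: (sqr_ge0 (qre q)) (sqr_ge0 (qj q)) (sqr_ge0 (qk q)); rewrite !expr2; lra.
Qed.
Lemma qj_le q : `|qj q| <= `|q|.
Proof.
rewrite -(@ler_pXn2r _ 2) ?nnegrE // real_normK ?num_real // qnorm2 /qdot.
by move: (sqr_ge0 (qi q)) (sqr_ge0 (qre q)) (sqr_ge0 (qk q)); rewrite !expr2; lra.
Qed.
Lemma qk_le q : `|qk q| <= `|q|.
Proof.
rewrite -(@ler_pXn2r _ 2) ?nnegrE // real_normK ?num_real // qnorm2 /qdot.
by move: (sqr_ge0 (qi q)) (sqr_ge0 (qj q)) (sqr_ge0 (qre q)); rewrite !expr2; lra.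
Qed.

Lemma quat_decomp q : q = qre q *: 1 + qi q *: Quat 0 1 0 0
  + qj q *: Quat 0 0 1 0 + qk q *: Quat 0 0 0 1.
Proof. by apply: quat_ext; rewrite !quatE /=; ring. Qed.

Lemma qnorm_le4 q :
  `|q| <= `|qre q| + `|qi q| + `|qj q| + `|qk q|.
Proof.
rewrite -(@ler_pXn2r _ 2) ?nnegrE ?addr_ge0 // qnorm2 /qdot.
rewrite -!(expr2 _) -[X in X + _ + _ + _]real_normK ?num_real //.
rewrite -[X in _ + X + _ + _]real_normK ?num_real //.
rewrite -[X in _ + X + _]real_normK ?num_real //.
rewrite -[X in _ + X <= _]real_normK ?num_real //.
move: (normr_ge0 (qre q)) (normr_ge0 (qi q)) (normr_ge0 (qj q)) (normr_ge0 (qk q)).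
move: `|qre q| `|qi q| `|qj q| `|qk q| => a b c d; nra.
Qed.

End QuaternionNorm.

(** * Continuity of quaternion-valued functions, coordinate by coordinate *)

Section QuaternionContinuity.
Variables (R : realType) (T : topologicalType).
Implicit Types (F G : T -> quat R) (x : T).

Lemma continuous_coord (c : quat R -> R) F x :
  {morph c : p q / p - q} -> (forall q, `|c q| <= `|q|) ->
  {for x, continuous F} -> {for x, continuous (c \o F)}.
Proof.
move=> cB c_le Fx; apply/cvgrPdist_lt => e e0.
have /cvgrPdist_lt/(_ e e0) := Fx.
by apply: filterS => y; apply: le_lt_trans; rewrite /= -cB.
Qed.

Lemma continuous_qre F x : {for x, continuous F} -> {for x, continuous (fun y => qre (F y))}.
Proof. by apply: continuous_coord => // q; exact: qre_le. Qed.
Lemma continuous_qi F x : {for x, continuous F} -> {for x, continuous (fun y => qi (F y))}.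
Proof. by apply: continuous_coord => // q; exact: qi_le. Qed.
Lemma continuous_qj F x : {for x, continuous F} -> {for x, continuous (fun y => qj (F y))}.
Proof. by apply: continuous_coord => // q; exact: qj_le. Qed.
Lemma continuous_qk F x : {for x, continuous F} -> {for x, continuous (fun y => qk (F y))}.
Proof. by apply: continuous_coord => // q; exact: qk_le. Qed.

Lemma continuous_quat F x :
  {for x, continuous (fun y => qre (F y))} -> {for x, continuous (fun y => qi (F y))} ->
  {for x, continuous (fun y => qj (F y))} -> {for x, continuous (fun y => qk (F y))} ->
  {for x, continuous F}.
Proof.
move=> c1 c2 c3 c4.
rewrite (_ : F = fun y => qre (F y) *: (1 : quat R) + qi (F y) *: Quat 0 1 0 0
  + qj (F y) *: Quat 0 0 1 0 + qk (F y) *: Quat 0 0 0 1); last first.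
  by apply/funext => y; exact: quat_decomp.
by apply: cvgD; [apply: cvgD; [apply: cvgD|]|]; apply: cvgZr_tmp.
Qed.

Lemma continuous_qmul F G x : {for x, continuous F} -> {for x, continuous G} ->
  {for x, continuous (fun y => F y * G y)}.
Proof.
move=> cF cG.
have cF1 := continuous_qre cF; have cF2 := continuous_qi cF.
have cF3 := continuous_qj cF; have cF4 := continuous_qk cF.
have cG1 := continuous_qre cG; have cG2 := continuous_qi cG.
have cG3 := continuous_qj cG; have cG4 := continuous_qk cG.
apply: continuous_quat => /=.
- by apply: cvgB; [apply: cvgB; [apply: cvgB|]|]; apply: cvgM.
- by apply: cvgB; [apply: cvgD; [apply: cvgD|]|]; apply: cvgM.
- by apply: cvgD; [apply: cvgD; [apply: cvgB|]|]; apply: cvgM.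
- by apply: cvgD; [apply: cvgB; [apply: cvgD|]|]; apply: cvgM.
Qed.

Lemma continuous_qinv F x : {for x, continuous F} -> F x != 0 ->
  {for x, continuous (fun y => qinv (F y))}.
Proof.
move=> cF Fx0.
have cN : {for x, continuous (fun y => `|F y| ^- 2)}.
  apply: cvgV; first by rewrite expf_neq0 // normr_eq0.
  by under eq_fun do rewrite expr2; apply: cvgM; apply: cvg_norm.
apply: continuous_quat => /=; apply: cvgM => //.
- exact: continuous_qre.
- by apply: cvgN; exact: continuous_qi.
- by apply: cvgN; exact: continuous_qj.
- by apply: cvgN; exact: continuous_qk.
Qed.

End QuaternionContinuity.

(** * Integrals of continuous quaternion-valued functions over segments *)

Section Integral.
Variable R : realType.
Implicit Types (a b c : R) (f g : R -> R) (F G : R -> quat R) (q : quat R).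

Definition rint a b f : R := \int[@lebesgue_measure R]_(x in `[a, b]) f x.

(** Continuity is asked on the whole line, so that it is the only side condition of the rules below.
    Integrands controlled only near the segment have to be extended first, as [clamp] does later. *)
Lemma continuous_integrable a b f : continuous f ->
  (@lebesgue_measure R).-integrable `[a, b] (EFin \o f).
Proof.
move=> cf; apply: continuous_compact_integrable; first exact: segment_compact.
exact: continuous_subspaceT.
Qed.
Local Hint Resolve continuous_integrable : core.

Lemma eq_rint a b f g : {in `[a, b], f =1 g} -> rint a b f = rint a b g.
Proof. by move=> fg; apply: eq_Rintegral => x; rewrite inE => /fg. Qed.

Lemma rintD a b f g : continuous f -> continuous g ->
  rint a b (fun x => f x + g x) = rint a b f + rint a b g.
Proof. by move=> cf cg; rewrite /rint RintegralD //; exact: continuous_integrable. Qed.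

Lemma rintB a b f g : continuous f -> continuous g ->
  rint a b (fun x => f x - g x) = rint a b f - rint a b g.
Proof. by move=> cf cg; rewrite /rint RintegralB //; exact: continuous_integrable. Qed.

Lemma rintZ a b c f : continuous f ->
  rint a b (fun x => c * f x) = c * rint a b f.
Proof. by move=> cf; rewrite /rint RintegralZl //; exact: continuous_integrable. Qed.

Lemma rint_cst a b c : a <= b -> rint a b (fun=> c) = c * (b - a).
Proof.
move=> ab; rewrite /rint Rintegral_cst //.
congr (_ * _); apply: (etrans (congr1 fine (lebesgue_measure_itv `[a, b]))).
by move: ab; rewrite /= lte_fin le_eqVlt => /predU1P[->|->]; rewrite ?ltxx ?subrr.
Qed.

Lemma le_rint a b f g : continuous f -> continuous g ->
  (forall x, a <= x <= b -> f x <= g x) -> rint a b f <= rint a b g.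
Proof.
move=> cf cg fg; by apply: le_Rintegral => //; exact: continuous_integrable.
Qed.

Lemma rint_split a b c f : continuous f -> a <= b -> b <= c ->
  rint a c f = rint a b f + rint b c f.
Proof.
move=> cf ab bc; rewrite /rint.
have := @Rintegral_itvB R f (BLeft a) (BRight c) b (continuous_integrable a c cf).
rewrite !bnd_simp => /(_ ab bc) /eqP; rewrite subr_eq => /eqP ->.
rewrite addrC; congr (_ + _); rewrite Rintegral_itv_obnd_cbnd //.
apply: integrableS (continuous_integrable b c cf) => //.
exact: subset_itv_oc_cc.
Qed.

Definition qint a b F : quat R :=
  Quat (rint a b (fun t => qre (F t))) (rint a b (fun t => qi (F t)))
    (rint a b (fun t => qj (F t))) (rint a b (fun t => qk (F t))).

Lemma eq_qint a b F G : {in `[a, b], F =1 G} -> qint a b F = qint a b G.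
Proof. by move=> FG; apply: quat_ext => /=; apply: eq_rint => x /FG ->. Qed.

Lemma cqre F : continuous F -> continuous (fun y => qre (F y)).
Proof. by move=> cF x; exact: (continuous_qre (cF x)). Qed.
Lemma cqi F : continuous F -> continuous (fun y => qi (F y)).
Proof. by move=> cF x; exact: (continuous_qi (cF x)). Qed.
Lemma cqj F : continuous F -> continuous (fun y => qj (F y)).
Proof. by move=> cF x; exact: (continuous_qj (cF x)). Qed.
Lemma cqk F : continuous F -> continuous (fun y => qk (F y)).
Proof. by move=> cF x; exact: (continuous_qk (cF x)). Qed.
Local Hint Resolve cqre cqi cqj cqk : core.

Lemma qintD a b F G : continuous F -> continuous G ->
  qint a b (fun t => F t + G t) = qint a b F + qint a b G.
Proof. by move=> cF cG; apply: quat_ext => /=; rewrite -rintD; auto. Qed.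

Lemma qintB a b F G : continuous F -> continuous G ->
  qint a b (fun t => F t - G t) = qint a b F - qint a b G.
Proof. by move=> cF cG; apply: quat_ext => /=; rewrite -rintB; auto. Qed.

Let crM c f : continuous f -> continuous (fun x => c * f x).
Proof. by move=> cf x; apply: cvgM; [exact: cvg_cst|exact: cf]. Qed.
Let crD f g : continuous f -> continuous g -> continuous (fun x => f x + g x).
Proof. by move=> cf cg x; apply: cvgD; [exact: cf|exact: cg]. Qed.
Let crB f g : continuous f -> continuous g -> continuous (fun x => f x - g x).
Proof. by move=> cf cg x; apply: cvgB; [exact: cf|exact: cg]. Qed.
Local Hint Resolve crM crD crB : core.

(** Every coordinate of a product with a constant quaternion has this shape; [rint_qdot],
    [qint_mull] and [qint_mulr] reorder their terms to reach it. *)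
Lemma rint_lin4 a b c1 c2 c3 c4 f1 f2 f3 f4 :
  continuous f1 -> continuous f2 -> continuous f3 -> continuous f4 ->
  rint a b (fun t => c1 * f1 t + c2 * f2 t + c3 * f3 t + c4 * f4 t) =
  c1 * rint a b f1 + c2 * rint a b f2 + c3 * rint a b f3 + c4 * rint a b f4.
Proof. by move=> ? ? ? ?; rewrite !rintD ?rintZ; auto 10. Qed.

Lemma rint_qdot a b q F : continuous F ->
  rint a b (fun t => qdot q (F t)) = qdot q (qint a b F).
Proof. by move=> cF; rewrite rint_lin4; auto. Qed.

Lemma qint_mull a b q F : continuous F ->
  qint a b (fun t => q * F t) = q * qint a b F.
Proof.
move=> cF; apply: quat_ext; rewrite !quatE /=.
- rewrite -!mulNr -rint_lin4; auto.
  by apply: eq_rint => t _; rewrite !mulNr.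
- rewrite (_ : _ - _ = qi q * rint a b (fun t => qre (F t)) +
    qre q * rint a b (fun t => qi (F t)) + - qk q * rint a b (fun t => qj (F t))
    + qj q * rint a b (fun t => qk (F t))); last by ring.
  by rewrite -rint_lin4; auto; apply: eq_rint => t _; ring.
- rewrite (_ : _ + _ = qj q * rint a b (fun t => qre (F t)) +
    qk q * rint a b (fun t => qi (F t)) + qre q * rint a b (fun t => qj (F t))
    + - qi q * rint a b (fun t => qk (F t))); last by ring.
  by rewrite -rint_lin4; auto; apply: eq_rint => t _; ring.
- rewrite (_ : _ + _ = qk q * rint a b (fun t => qre (F t)) +
    - qj q * rint a b (fun t => qi (F t)) + qi q * rint a b (fun t => qj (F t))
    + qre q * rint a b (fun t => qk (F t))); last by ring.
  by rewrite -rint_lin4; auto; apply: eq_rint => t _; ring.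
Qed.

Lemma qint_mulr a b q F : continuous F ->
  qint a b (fun t => F t * q) = qint a b F * q.
Proof.
move=> cF; apply: quat_ext; rewrite !quatE /=.
- rewrite (_ : _ - _ = qre q * rint a b (fun t => qre (F t)) +
    - qi q * rint a b (fun t => qi (F t)) + - qj q * rint a b (fun t => qj (F t))
    + - qk q * rint a b (fun t => qk (F t))); last by ring.
  by rewrite -rint_lin4; auto; apply: eq_rint => t _; ring.
- rewrite (_ : _ - _ = qi q * rint a b (fun t => qre (F t)) +
    qre q * rint a b (fun t => qi (F t)) + qk q * rint a b (fun t => qj (F t))
    + - qj q * rint a b (fun t => qk (F t))); last by ring.
  by rewrite -rint_lin4; auto; apply: eq_rint => t _; ring.
- rewrite (_ : _ + _ = qj q * rint a b (fun t => qre (F t)) +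
    - qk q * rint a b (fun t => qi (F t)) + qre q * rint a b (fun t => qj (F t))
    + qi q * rint a b (fun t => qk (F t))); last by ring.
  by rewrite -rint_lin4; auto; apply: eq_rint => t _; ring.
- rewrite (_ : _ + _ = qk q * rint a b (fun t => qre (F t)) +
    qj q * rint a b (fun t => qi (F t)) + - qi q * rint a b (fun t => qj (F t))
    + qre q * rint a b (fun t => qk (F t))); last by ring.
  by rewrite -rint_lin4; auto; apply: eq_rint => t _; ring.
Qed.

Lemma qint_cst a b q : a <= b -> qint a b (fun=> q) = (b - a) *: q.
Proof. by move=> ab; apply: quat_ext => /=; rewrite rint_cst // mulrC. Qed.

Lemma qint_split a b c F : continuous F -> a <= b -> b <= c ->
  qint a c F = qint a b F + qint b c F.
Proof. by move=> cF ab bc; apply: quat_ext => /=; rewrite -rint_split; auto. Qed.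

Lemma rint_norm_le a b e f : continuous f -> a <= b ->
  (forall t, a <= t <= b -> `|f t| <= e) -> `|rint a b f| <= e * (b - a).
Proof.
move=> cf ab fe; rewrite ler_norml -mulNr -!rint_cst //.
have cc c : continuous (fun _ : R => c) by move=> ?; exact: cvg_cst.
apply/andP; split; apply: le_rint => // x /fe; rewrite ler_norml => /andP[] //.
Qed.

(** The factor 4 comes from bounding the four coordinates separately. It is harmless: the estimates
    built on it only need smallness or a geometric rate. *)
Lemma qint_norm_le a b e F : continuous F -> a <= b ->
  (forall t, a <= t <= b -> `|F t| <= e) -> `|qint a b F| <= 4 * (b - a) * e.
Proof.
move=> cF ab Fe; apply: le_trans (qnorm_le4 _) _ => /=.
have H (c : quat R -> R) : continuous (c \o F) -> (forall q, `|c q| <= `|q|) ->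
    `|rint a b (c \o F)| <= e * (b - a).
  move=> cc cle; apply: rint_norm_le => // t /Fe; apply: le_trans; exact: cle.
have := H (@qre R) (cqre cF) (@qre_le R).
have := H (@qi R) (cqi cF) (@qi_le R).
have := H (@qj R) (cqj cF) (@qj_le R).
have := H (@qk R) (cqk cF) (@qk_le R).
rewrite /comp; lra.
Qed.

Lemma qint_near a b e q F : continuous F -> a <= b ->
  (forall t, a <= t <= b -> `|F t - q| <= e) ->
  `|qint a b F - (b - a) *: q| <= 4 * (b - a) * e.
Proof.
move=> cF ab Fe; have cc : continuous (fun _ : R => q) by move=> ?; exact: cvg_cst.
rewrite -qint_cst // -qintB //; apply: qint_norm_le => //.
by move=> x; apply: cvgB; [exact: cF|exact: cc].
Qed.

Lemma continuous_qsum (J : Type) (l : seq J) (P : pred J) (F : J -> R -> quat R) :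
  (forall j, continuous (F j)) -> continuous (fun t => \sum_(j <- l | P j) F j t).
Proof.
move=> cF; elim: l => [|j l IH] x.
  by under eq_fun do rewrite big_nil; exact: cvg_cst.
under eq_fun do rewrite big_cons.
by case: ifP => _; rewrite ?big_cons; [apply: cvgD; [exact: cF|exact: IH]|exact: IH].
Qed.

Lemma qint_sum (J : Type) (s : seq J) (P : pred J) a b (F : J -> R -> quat R) :
  (forall j, continuous (F j)) ->
  qint a b (fun t => \sum_(j <- s | P j) F j t) = \sum_(j <- s | P j) qint a b (F j).
Proof.
move=> cF; elim: s => [|j s IH].
  rewrite big_nil; under [X in qint _ _ X]eq_fun do rewrite big_nil.
  have := @qint_mull a b 0 (fun=> 0); rewrite !mul0r; apply.
  by move=> ?; exact: cvg_cst.
rewrite big_cons; under [X in qint _ _ X]eq_fun do rewrite big_cons.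
by case: ifP => _; rewrite ?qintD // ?IH //; exact: continuous_qsum.
Qed.

End Integral.

(** * Points of a slice and complex differentiability there *)

Section SlicePoints.
Variables (R : realType) (I : quat R).
Hypothesis I2 : imag_units R I.
Implicit Types (p q : R * R) (F G : R * R -> quat R).

(** The imaginary coordinates of [I ^+ 2] are twice the products of [qre I] with those of [I]. If
    [qre I] were nonzero, these would vanish and a real number would have square -1. *)
Lemma imag_unit_re : qre I = 0.
Proof.
have := I2; rewrite /imag_units /= expr2 !quatE; case=> e1 e2 e3 e4.
have [//|n0] := eqVneq (qre I) 0.
have z (x : R) : qre I * x + x * qre I = 0 -> x = 0.
  rewrite [x * _]mulrC -mulr2n => /eqP; rewrite mulrn_eq0 /= mulf_eq0 (negbTE n0) /=.
  by move/eqP.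
have zi : qi I = 0 by apply: z; rewrite -[RHS]oppr0 -e2; ring.
have zj : qj I = 0 by apply: z; rewrite -[RHS]oppr0 -e3; ring.
have zk : qk I = 0 by apply: z; rewrite -[RHS]oppr0 -e4; ring.
move: e1; rewrite zi zj zk => e1.
have := sqr_ge0 (qre I); rewrite expr2; lra.
Qed.

Lemma imag_unit_mul : I * I = -1.
Proof. by have := I2; rewrite /imag_units /= expr2. Qed.

Lemma imag_unit_qdot : qdot I I = 1.
Proof.
have := imag_unit_mul; rewrite !quatE => -[e1 _ _ _].
by move: e1; rewrite /qdot imag_unit_re; lra.
Qed.

Lemma imag_unit_norm : `|I| = 1.
Proof.
apply/eqP; rewrite -(@eqrXn2 _ 2) //; apply/eqP.
by rewrite qnorm2 imag_unit_qdot expr1n.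
Qed.

Lemma slice_ptB p q : slice_pt I (p - q) = slice_pt I p - slice_pt I q.
Proof. by apply: quat_ext; rewrite /slice_pt !quatE /=; ring. Qed.

Lemma slice_ptC p q : slice_pt I p * slice_pt I q = slice_pt I q * slice_pt I p.
Proof. by apply: quat_ext; rewrite /slice_pt !quatE /=; ring. Qed.

Lemma slice_pt_norm2 p : `|slice_pt I p| ^+ 2 = p.1 ^+ 2 + p.2 ^+ 2.
Proof.
rewrite qnorm2 [RHS](_ : _ = p.1 ^+ 2 + p.2 ^+ 2 * qdot I I).
  by rewrite /qdot /slice_pt !quatE /= imag_unit_re; ring.
by rewrite imag_unit_qdot mulr1.
Qed.

(** [R * R] carries the maximum norm, so it is not isometric to the slice. This bound and the next
    one transfer little-o conditions between the two norms. *)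
Lemma slice_pt_norm_ge p : `|p| <= `|slice_pt I p|.
Proof.
rewrite prod_normE ge_max; apply/andP; split;
  rewrite -(@ler_pXn2r _ 2) ?nnegrE // slice_pt_norm2 real_normK ?num_real //.
  by rewrite lerDl sqr_ge0.
by rewrite lerDr sqr_ge0.
Qed.

Lemma slice_pt_norm_le p : `|slice_pt I p| <= 2 * `|p|.
Proof.
rewrite /slice_pt; apply: le_trans (ler_normD _ _) _.
rewrite !normrZ qnorm1 imag_unit_norm !mulr1 prod_normE.
by rewrite mulr_natl mulr2n lerD // le_max lexx ?orbT.
Qed.

Lemma slice_pt_eq0 p : (slice_pt I p == 0) = (p == 0).
Proof.
apply/idP/idP => /eqP.
  move=> /(congr1 Num.norm) E.
  by have := slice_pt_norm_ge p; rewrite E normr0 normr_le0.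
by move=> ->; rewrite /slice_pt /= !scale0r addr0.
Qed.

Lemma continuous_slice_pt : continuous (slice_pt I).
Proof.
move=> p; apply: cvgD; apply: cvgZr_tmp; [exact: cvg_fst|exact: cvg_snd].
Qed.

(** The inverse of a point of the slice lies in the slice, which is commutative. *)
Lemma slice_pt_qinvC p q :
  slice_pt I p * qinv (slice_pt I q) = qinv (slice_pt I q) * slice_pt I p.
Proof.
have -> : qinv (slice_pt I q) = slice_pt I (`|slice_pt I q| ^- 2 * q.1, - (`|slice_pt I q| ^- 2 * q.2)).
  rewrite /qinv; move: (_ ^- 2) => c.
  by apply: quat_ext; rewrite /qconj /slice_pt !quatE /= ?imag_unit_re; ring.
exact: slice_ptC.
Qed.

(* Caratheodory's form of complex differentiability on the slice: the
   difference quotient [H] extends continuously to [p]. *)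
Definition holomorphic_at F p := exists H : R * R -> quat R,
  {for p, continuous H} /\ forall q, F q = F p + slice_pt I (q - p) * H q.

(** With [holo_small] this passes between two forms of differentiability: the factored one suits
    products and composition, the little-o one suits locality and the local estimate of Goursat. *)
Lemma holo_of_small F p L :
  (forall e, 0 < e -> \forall q \near p,
     `|F q - F p - slice_pt I (q - p) * L| <= e * `|q - p|) -> holomorphic_at F p.
Proof.
move=> small; exists (fun q => if q == p then L else
  qinv (slice_pt I (q - p)) * (F q - F p)); split; last first.
  move=> q; have [->|qp] := eqVneq q p.
    by rewrite subrr /slice_pt /= !scale0r addr0 mul0r addr0.
  by rewrite mulrA mul_qinv ?slice_pt_eq0 ?subr_eq0 // mul1r addrC subrK.
apply/cvgrPdist_lt => e e0; have := small (e / 2); rewrite divr_gt0 // => /(_ isT).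
apply: filterS => q; rewrite eqxx; have [->|qp] := eqVneq q p.
  by move=> _ /=; rewrite subrr normr0.
move=> le; have z0 : slice_pt I (q - p) != 0 by rewrite slice_pt_eq0 subr_eq0.
have : `|slice_pt I (q - p) * (qinv (slice_pt I (q - p)) * (F q - F p) - L)|
   <= e / 2 * `|slice_pt I (q - p)|.
  rewrite mulrBr mulrA mul_qinv // mul1r; apply: le_trans le _.
  by rewrite ler_pM2l ?divr_gt0 // slice_pt_norm_ge.
rewrite qnormM mulrC ler_pM2r ?normr_gt0 // distrC => /le_lt_trans; apply.
by rewrite ltr_pdivrMr // ltr_pMr // ltr1n.
Qed.

Lemma holo_small F p : holomorphic_at F p -> exists L, forall e, 0 < e ->
  \forall q \near p, `|F q - F p - slice_pt I (q - p) * L| <= e * `|q - p|.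
Proof.
move=> [H [cH FH]]; exists (H p) => e e0.
have /cvgrPdist_lt/(_ (e / 2)) := cH; rewrite divr_gt0 // => /(_ isT).
apply: filterS => q lt; rewrite FH [F p + _]addrC addrK -mulrBr qnormM.
rewrite distrC; apply: le_trans (ler_pM _ _ (slice_pt_norm_le _) (ltW lt)) _ => //.
by rewrite [leLHS](_ : _ = e * `|q - p|) //; field.
Qed.

(** [holomorphic_at] demands the factorisation at every [q], so that locality is not visible in it;
    it is in the little-o form. *)
Lemma holo_near F G p : (\forall q \near p, F q = G q) -> holomorphic_at F p -> holomorphic_at G p.
Proof.
move=> FG /holo_small[L HL]; apply: (@holo_of_small _ _ L) => e /HL.
have FGp := nbhs_singleton FG.
by apply: filterS2 FG => q -> ; rewrite FGp.
Qed.

Lemma holo_continuous F p : holomorphic_at F p -> {for p, continuous F}.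
Proof.
move=> [H [cH FH]]; rewrite (_ : F = fun q => F p + slice_pt I (q - p) * H q).
  have : {for p, continuous (fun q => slice_pt I (q - p) * H q)}.
    apply: continuous_qmul => //.
    apply: (@continuous_comp _ _ _ (fun q => q - p) (slice_pt I)).
      by apply: cvgB; [exact: cvg_id|exact: cvg_cst].
    exact: continuous_slice_pt.
  by move=> c; apply: cvgD; [exact: cvg_cst|exact: c].
by apply/funext.
Qed.

End SlicePoints.

(** * Goursat's subdivision argument for an abstract additive function of rectangles *)

Section Goursat.
Variable R : realType.
Implicit Types (a b c d x y : R).

(** The point is the supremum of the left ends: every right end bounds all left ends. *)
Lemma nested_intervals (u : nat -> R) (w : R) : 0 <= w ->
  (forall n, u n <= u n.+1) ->
  (forall n, u n.+1 + w / 2 ^+ n.+1 <= u n + w / 2 ^+ n) ->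
  exists x, forall n, u n <= x <= u n + w / 2 ^+ n.
Proof.
move=> w0 ul ur.
have wn n : 0 <= w / 2 ^+ n by rewrite divr_ge0 // exprn_ge0.
have mono n k : u n <= u (n + k)%N.
  by elim: k => [|k IH]; rewrite ?addn0 // addnS; exact: le_trans IH _.
have anti n k : u (n + k)%N + w / 2 ^+ (n + k) <= u n + w / 2 ^+ n.
  by elim: k => [|k IH]; rewrite ?addn0 // addnS; exact: le_trans (ur _) IH.
have ub m n : u m <= u n + w / 2 ^+ n.
  have [mn|nm] := leqP m n.
    by apply: (@le_trans _ _ (u n)); [rewrite -(subnKC mn)|rewrite lerDl].
  apply: (@le_trans _ _ (u m + w / 2 ^+ m)); first by rewrite lerDl.
  by rewrite -(subnKC (ltnW nm)).
exists (sup (range u)) => n; apply/andP; split.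
  apply: ub_le_sup; last by exists n.
  by exists (u 0%N + w / 2 ^+ 0) => _ [m _ <-].
by apply: ge_sup; [exists (u 0%N), 0%N|move=> _ [m _ <-]].
Qed.

Variable E : R -> R -> R -> R -> quat R.
Hypothesis Eh : forall a m b c d, a <= m -> m <= b ->
  E a b c d = E a m c d + E m b c d.
Hypothesis Ev : forall a b c m d, c <= m -> m <= d ->
  E a b c d = E a b c m + E a b m d.

(** Pigeonhole: if all four quarters fell below a quarter of the whole, so would their sum. The
    corner of the good quarter is returned with the inequalities that nest it in the rectangle. *)
Lemma quarter_dominates s t w h : 0 <= w -> 0 <= h -> exists p : R * R,
  [/\ s <= p.1, p.1 + w <= s + w + w, t <= p.2, p.2 + h <= t + h + h &
   `|E s (s + w + w) t (t + h + h)| <= 4 * `|E p.1 (p.1 + w) p.2 (p.2 + h)| ].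
Proof.
move=> w0 h0.
have : `|E s (s + w + w) t (t + h + h)| <=
    `|E s (s + w) t (t + h)| + `|E s (s + w) (t + h) (t + h + h)| +
    (`|E (s + w) (s + w + w) t (t + h)| +
     `|E (s + w) (s + w + w) (t + h) (t + h + h)|).
  rewrite (@Eh s (s + w)) ?lerDl // (@Ev s (s + w) t (t + h)) ?lerDl //.
  rewrite (@Ev (s + w) (s + w + w) t (t + h)) ?lerDl //.
  by apply: le_trans (ler_normD _ _) _; rewrite lerD // ler_normD.
move=> sum4.
have [?|lt1] := lerP `|E s (s + w + w) t (t + h + h)| (4 * `|E s (s + w) t (t + h)|).
  by exists (s, t); split => //=; lra.
have [?|lt2] := lerP `|E s (s + w + w) t (t + h + h)|
    (4 * `|E s (s + w) (t + h) (t + h + h)|).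
  by exists (s, t + h); split => //=; lra.
have [?|lt3] := lerP `|E s (s + w + w) t (t + h + h)|
    (4 * `|E (s + w) (s + w + w) t (t + h)|).
  by exists (s + w, t); split => //=; lra.
by exists (s + w, t + h); split => //=; lra.
Qed.

(** Each subdivision costs a factor 4 in the size of [E] and gains a factor 4 in the square of the
    half perimeter. Smallness of second order at the limit point therefore forces 0. *)
Lemma quadrisection a b c d : a <= b -> c <= d ->
  (forall x y, a <= x <= b -> c <= y <= d -> forall e, 0 < e ->
     exists2 r, 0 < r & forall a' b' c' d',
       a' <= x <= b' -> c' <= y <= d' -> b' - a' <= r -> d' - c' <= r ->
       `|E a' b' c' d'| <= e * ((b' - a') + (d' - c')) ^+ 2) ->
  E a b c d = 0.
Proof.
move=> ab cd local; pose w := b - a; pose h := d - c.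
have w0 : 0 <= w by rewrite subr_ge0.
have h0 : 0 <= h by rewrite subr_ge0.
pose Q n (p : R * R) := E p.1 (p.1 + w / 2 ^+ n) p.2 (p.2 + h / 2 ^+ n).
have halve (v : R) n : v / 2 ^+ n = v / 2 ^+ n.+1 + v / 2 ^+ n.+1.
  by rewrite exprS invfM; field; rewrite expf_neq0.
have ge0 (v : R) n : 0 <= v -> 0 <= v / 2 ^+ n.
  by move=> v0; rewrite divr_ge0 // exprn_ge0.
have step n (p : R * R) : exists p' : R * R,
    [/\ p.1 <= p'.1, p'.1 + w / 2 ^+ n.+1 <= p.1 + w / 2 ^+ n,
     p.2 <= p'.2, p'.2 + h / 2 ^+ n.+1 <= p.2 + h / 2 ^+ n &
     `|Q n p| <= 4 * `|Q n.+1 p'| ].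
  rewrite /Q (halve w n) (halve h n) !addrA.
  exact: quarter_dominates (ge0 w n.+1 w0) (ge0 h n.+1 h0).
(* Good quarters are chosen for all stages and corners at once; [u] then iterates the choice from
   the corner (a, c). *)
have [g gP] := choice (fun np : nat * (R * R) => step np.1 np.2).
pose u := fix u n := if n is m.+1 then g (m, u m) else (a, c).
have uP n := gP (n, u n).
have [x xP] := @nested_intervals (fun n => (u n).1) w w0
  (fun n => let: And5 h _ _ _ _ := uP n in h)
  (fun n => let: And5 _ h _ _ _ := uP n in h).
have [y yP] := @nested_intervals (fun n => (u n).2) h h0
  (fun n => let: And5 _ _ h _ _ := uP n in h)
  (fun n => let: And5 _ _ _ h _ := uP n in h).
have Qn n : `|E a b c d| <= 4 ^+ n * `|Q n (u n)|.
  elim: n => [|n IH].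
    by rewrite expr0 mul1r /Q /= expr0 !divr1 /w /h ![_ + (_ - _)]addrC !subrK.
  apply: le_trans IH _; rewrite exprS [4 * _]mulrC -mulrA ler_pM2l ?exprn_gt0 //.
  by case: (uP n).
have xab : a <= x <= b.
  by have := xP 0%N; rewrite /= expr0 divr1 /w [a + _]addrC subrK.
have ycd : c <= y <= d.
  by have := yP 0%N; rewrite /= expr0 divr1 /h [c + _]addrC subrK.
apply/eqP; rewrite -normr_le0; apply/ler_addgt0Pr => e e0; rewrite add0r.
have C0 : 0 < (w + h) ^+ 2 + 1 :> R by rewrite ltr_wpDl ?sqr_ge0.
(* The added 1 keeps the denominator positive when the rectangle is a point. *)
have [r r0 rP] := local x y xab ycd (e / ((w + h) ^+ 2 + 1)) (divr_gt0 e0 C0).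
have [n nP] : exists n, (w + h) / 2 ^+ n <= r.
  have := @cvg_geometric R (w + h) (2^-1).
  rewrite ger0_norm // invf_lt1 // ltr1n => /(_ isT) /cvgrPdist_le /(_ r r0).
  move=> [n _ /(_ n (leqnn n))] /=; rewrite sub0r normrN exprVn => le; exists n.
  by apply: le_trans (ler_norm _) le.
apply: le_trans (Qn n) _.
have : `|Q n (u n)| <= e / ((w + h) ^+ 2 + 1) * (w / 2 ^+ n + h / 2 ^+ n) ^+ 2.
  have kz (z v : R) : z + v - z = v by ring.
  have := rP _ _ _ _ (xP n) (yP n); rewrite !kz; apply.
    by apply: le_trans _ nP; rewrite (mulrDl w h) lerDl ge0.
  by apply: le_trans _ nP; rewrite (mulrDl w h) lerDr ge0.
move=> le; apply: (@le_trans _ _ (4 ^+ n * (e / ((w + h) ^+ 2 + 1) * (w / 2 ^+ n + h / 2 ^+ n) ^+ 2))).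
  by rewrite ler_pM2l // exprn_gt0.
rewrite -(mulrDl w h) exprMn exprVn -exprM mulnC exprM.
rewrite (_ : 2 ^+ 2 = 4 :> R); last by ring.
rewrite [X in X <= _](_ : _ = e * ((w + h) ^+ 2 / ((w + h) ^+ 2 + 1))); last first.
  by field; rewrite (gt_eqF C0) /= expf_neq0.
by rewrite ler_piMr ?(ltW e0) // ler_pdivrMr // mul1r lerDl.
Qed.

End Goursat.

Lemma continuous_pair (T U V : topologicalType) (f : T -> U) (g : T -> V) (x : T) :
  {for x, continuous f} -> {for x, continuous g} ->
  {for x, continuous (fun y => (f y, g y))}.
Proof. by move=> cf cg; exact: (cvg_pair cf cg). Qed.

(** * Cauchy's theorem for rectangles in a slice *)

Section CauchyRectangle.
Variables (R : realType) (I : quat R).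
Hypothesis I2 : imag_units R I.
Implicit Types (F : R * R -> quat R).

(* The integral of dz F over the boundary of [a, b] x [c, d]: dz = ds on the horizontal
   sides, dz = I dt on the vertical ones. *)
Definition boundary_int F a b c d : quat R :=
  I * (qint c d (fun t => F (b, t)) - qint c d (fun t => F (a, t)))
  - (qint a b (fun s => F (s, d)) - qint a b (fun s => F (s, c))).

Lemma continuous_vert F a : continuous F -> continuous (fun t : R => F (a, t)).
Proof.
move=> cF t; apply: (@continuous_comp _ _ _ (fun t : R => (a, t)) F); last exact: cF.
by apply: continuous_pair; [exact: cvg_cst|exact: cvg_id].
Qed.

Lemma continuous_horiz F a : continuous F -> continuous (fun s : R => F (s, a)).
Proof.
move=> cF t; apply: (@continuous_comp _ _ _ (fun t : R => (t, a)) F); last exact: cF.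
by apply: continuous_pair; [exact: cvg_id|exact: cvg_cst].
Qed.

Lemma boundary_int_hsplit F a m b c d : continuous F -> a <= m -> m <= b ->
  boundary_int F a b c d = boundary_int F a m c d + boundary_int F m b c d.
Proof.
move=> cF am mb; rewrite /boundary_int.
rewrite !(qint_split (continuous_horiz cF) am mb).
move: (qint _ _ _) (qint _ _ _) (qint _ _ _) (qint _ _ _) (qint _ _ _)
  (qint _ _ _) (qint _ _ _) => x1 x2 x3 x4 x5 x6 x7.
by apply: quat_ext; rewrite !quatE /=; ring.
Qed.

Lemma boundary_int_vsplit F a b c m d : continuous F -> c <= m -> m <= d ->
  boundary_int F a b c d = boundary_int F a b c m + boundary_int F a b m d.
Proof.
move=> cF cm md; rewrite /boundary_int.
rewrite !(qint_split (continuous_vert cF) cm md).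
move: (qint _ _ _) (qint _ _ _) (qint _ _ _) (qint _ _ _) (qint _ _ _)
  (qint _ _ _) (qint _ _ _) => x1 x2 x3 x4 x5 x6 x7.
by apply: quat_ext; rewrite !quatE /=; ring.
Qed.

Lemma norm_sub_le_sides (x y a b c d : R) (q : R * R) :
  a <= x <= b -> c <= y <= d -> a <= q.1 <= b -> c <= q.2 <= d ->
  `|q - (x, y)| <= (b - a) + (d - c).
Proof.
move=> h1 h2 h3 h4; rewrite prod_normE /= ge_max !ler_norml.
by apply/andP; split; apply/andP; split; lra.
Qed.

(** An affine integrand has boundary integral 0: opposite vertical sides differ by [(b - a) *: L],
    horizontal ones by [(d - c) *: (I * L)], and the two contributions cancel. Only the remainder
    counts. The 8 is the 4 of [qint_near] times 2, since comparing opposite sides involves the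
    remainder at two points. *)
Lemma boundary_int_small F (x y e a b c d : R) (L : quat R) :
  continuous F -> a <= x <= b -> c <= y <= d -> 0 <= e ->
  (forall q, a <= q.1 <= b -> c <= q.2 <= d ->
    `|F q - F (x, y) - slice_pt I (q - (x, y)) * L| <= e * `|q - (x, y)|) ->
  `|boundary_int F a b c d| <= 8 * e * ((b - a) + (d - c)) ^+ 2.
Proof.
move=> cF axb cyd e0 small; pose s := (b - a) + (d - c).
have ab : a <= b by case/andP: axb; exact: le_trans.
have cd : c <= d by case/andP: cyd; exact: le_trans.
have rho q : a <= q.1 <= b -> c <= q.2 <= d ->
    `|F q - F (x, y) - slice_pt I (q - (x, y)) * L| <= e * s.
  move=> h1 h2; apply: le_trans (small q h1 h2) _.
  by rewrite ler_wpM2l // norm_sub_le_sides.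
have diff q q' v : a <= q.1 <= b -> c <= q.2 <= d -> a <= q'.1 <= b ->
    c <= q'.2 <= d -> slice_pt I (q - q') = v -> `|F q - F q' - v * L| <= 2 * (e * s).
  move=> h1 h2 h3 h4 <-.
  rewrite [X in `|X|](_ : _ = (F q - F (x, y) - slice_pt I (q - (x, y)) * L) -
    (F q' - F (x, y) - slice_pt I (q' - (x, y)) * L)); last first.
    by rewrite !slice_ptB; move: (F q) (F q') (F (x, y)) => u0 u1 u2;
      apply: quat_ext; rewrite !quatE /=; ring.
  apply: le_trans (ler_normB _ _) _; rewrite mulr_natl mulr2n.
  by rewrite lerD // rho.
have vert : `|qint c d (fun t => F (b, t) - F (a, t)) - (d - c) *: ((b - a) *: L)|
    <= 4 * (d - c) * (2 * (e * s)).
  apply: qint_near => //.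
    by move=> t; apply: cvgB; [exact: continuous_vert|exact: continuous_vert].
  move=> t ctd; rewrite -[L in _ *: L]mul1r scalerAl.
  apply: diff => //=; rewrite ?lexx ?ab //.
  by apply: quat_ext; rewrite /slice_pt !quatE /=; ring.
have horiz : `|qint a b (fun s => F (s, d) - F (s, c)) - (b - a) *: ((d - c) *: (I * L))|
    <= 4 * (b - a) * (2 * (e * s)).
  apply: qint_near => //.
    by move=> t; apply: cvgB; [exact: continuous_horiz|exact: continuous_horiz].
  move=> t atb; rewrite scalerAl.
  apply: diff => //=; rewrite ?lexx ?cd //.
  by apply: quat_ext; rewrite /slice_pt !quatE /=; ring.
rewrite /boundary_int -!qintB; try exact: continuous_vert; try exact: continuous_horiz.
rewrite [X in `|X|](_ : _ =
   I * (qint c d (fun t => F (b, t) - F (a, t)) - (d - c) *: ((b - a) *: L)) -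
   (qint a b (fun s => F (s, d) - F (s, c)) - (b - a) *: ((d - c) *: (I * L)))); last first.
  move: (qint _ _ _) (qint _ _ _) => u v.
  by apply: quat_ext; rewrite !quatE /=; ring.
apply: le_trans (ler_normB _ _) _; rewrite qnormM (imag_unit_norm I2) mul1r.
apply: le_trans (lerD vert horiz) _.
by rewrite le_eqVlt; apply/orP; left; apply/eqP; rewrite /s; ring.
Qed.

Lemma goursat F a b c d : continuous F -> a <= b -> c <= d ->
  (forall p, a <= p.1 <= b -> c <= p.2 <= d -> holomorphic_at I F p) ->
  boundary_int F a b c d = 0.
Proof.
move=> cF ab cd hF; apply: (quadrisection (E := boundary_int F)) => //.
- by move=> *; exact: boundary_int_hsplit.
- by move=> *; exact: boundary_int_vsplit.
move=> x y axb cyd e e0.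
(* [e / 8] absorbs the constant of [boundary_int_small]; below, sides of length at most [r / 2] keep
   the rectangle in the open ball of radius [r]. *)
have [L /(_ (e / 8))] := holo_small I2 (hF (x, y) axb cyd).
rewrite divr_gt0 // => /(_ isT) /nbhs_ballP[r /= r0 rP].
exists (r / 2); first by rewrite divr_gt0.
move=> a' b' c' d' h1 h2 h3 h4.
rewrite [e in e * _](_ : _ = 8 * (e / 8)); last by field.
apply: (boundary_int_small (L := L) cF h1 h2); first by rewrite divr_ge0 // ltW.
move=> q h5 h6; apply: rP; split; rewrite /ball /= ltr_norml; apply/andP; split; lra.
Qed.

End CauchyRectangle.

(** * Sums, products and inverses of complex differentiable functions *)

Section HoloCalculus.
Variables (R : realType) (I : quat R).
Hypothesis I2 : imag_units R I.
Implicit Types (F G A : R * R -> quat R) (p : R * R).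

Lemma holo_cst q p : holomorphic_at I (fun=> q) p.
Proof.
exists (fun=> 0); split; first exact: cvg_cst.
by move=> p'; rewrite mulr0 addr0.
Qed.

Lemma holoD F G p : holomorphic_at I F p -> holomorphic_at I G p -> holomorphic_at I (fun q => F q + G q) p.
Proof.
move=> [H [cH FH]] [K [cK GK]]; exists (fun q => H q + K q); split.
  by apply: cvgD.
by move=> q; rewrite FH GK mulrDr addrACA.
Qed.

Lemma holo_slice_pt p : holomorphic_at I (slice_pt I) p.
Proof.
exists (fun=> 1); split; first exact: cvg_cst.
by move=> q; rewrite mulr1 slice_ptB addrC subrK.
Qed.

(* Left multiplication by [A] is compatible with complex differentiability only
   when [A] takes its values in the slice, so that it commutes with increments. *)
Lemma holoM A F p : (forall q, slice_pt I q * A p = A p * slice_pt I q) ->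
  holomorphic_at I A p -> holomorphic_at I F p -> holomorphic_at I (fun q => A q * F q) p.
Proof.
move=> comm [H [cH AH]] hF; have [K [cK FK]] := hF.
exists (fun q => H q * F q + A p * K q); split.
  apply: cvgD; apply: continuous_qmul => //; last exact: cvg_cst.
  exact: holo_continuous hF.
move=> q; rewrite {1}AH mulrDl {1}FK mulrDr mulrA -comm -!mulrA -addrA.
by rewrite mulrDr [X in _ + X]addrC mulrA.
Qed.

(** From 1/(q-w) - 1/(p-w) = -(q-p) / ((q-w)(p-w)). This identity is only meant for [q] different
    from [w], whereas [holomorphic_at] wants a factorisation for all [q]; hence the comparison
    through [holo_near]. *)
Lemma holo_qinv (w p : R * R) : p != w -> holomorphic_at I (fun q : R * R => qinv (slice_pt I (q - w))) p.
Proof.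
move=> pw; have zp0 : slice_pt I (p - w) != 0 by rewrite slice_pt_eq0 // subr_eq0.
have cV : {for p, continuous (fun q : R * R => qinv (slice_pt I (q - w)))}.
  apply: continuous_qinv => //.
  apply: (@continuous_comp _ _ _ (fun q : R * R => q - w) (slice_pt I)).
    by apply: cvgB; [exact: cvg_id|exact: cvg_cst].
  exact: continuous_slice_pt.
apply: (@holo_near _ _ I2 (fun q : R * R => qinv (slice_pt I (p - w)) + slice_pt I (q - p) *
    - (qinv (slice_pt I (q - w)) * qinv (slice_pt I (p - w))))).
  have : {for p, continuous (fun q : R * R => `|q - w|)}.
    by apply: cvg_norm; apply: cvgB; [exact: cvg_id|exact: cvg_cst].
  move=> /cvgr_gt /(_ 0); rewrite normr_gt0 subr_eq0 => /(_ pw).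
  apply: filterS => q; rewrite normr_gt0 => qw.
  have zq0 : slice_pt I (q - w) != 0 by rewrite slice_pt_eq0.
  have -> : slice_pt I (q - p) = slice_pt I (q - w) - slice_pt I (p - w).
    by rewrite -slice_ptB; congr slice_pt; rewrite opprB addrA subrK.
  rewrite mulrN mulrBl opprB !mulrA (mul_qinv zq0) mul1r (slice_pt_qinvC I2).
  by rewrite -mulrA (mul_qinv zp0) mulr1 addrC subrK.
exists (fun q : R * R => - (qinv (slice_pt I (q - w)) * qinv (slice_pt I (p - w)))); split.
  have c : {for p, continuous (fun q : R * R =>
      qinv (slice_pt I (q - w)) * qinv (slice_pt I (p - w)))}.
    by apply: continuous_qmul => //; exact: cvg_cst.
  by apply: cvgN; exact: c.
by move=> q; rewrite subrr /slice_pt /= !scale0r addr0 mul0r addr0.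
Qed.

End HoloCalculus.

(** * Integrals over circles, in exponential coordinates *)

Section Circles.
Variables (R : realType) (I : quat R).
Hypothesis I2 : imag_units R I.
Implicit Types (F G : R * R -> quat R) (p q : R * R) (s t : R).

(** The complex exponential: the first coordinate is the logarithm of the radius, so the open disc
    without its centre is the half plane of negative first coordinate, and rectangles of height 2 pi
    become annuli. This lets Goursat's theorem for rectangles serve for circles. *)
Definition polar p : R * R := (expR p.1 * cos p.2, expR p.1 * sin p.2).

Lemma slice_pt_polar_norm p : `|slice_pt I (polar p)| = expR p.1.
Proof.
apply/eqP; rewrite -(@eqrXn2 _ 2) ?expR_ge0 //; apply/eqP.
by rewrite slice_pt_norm2 //= !exprMn -mulrDr cos2Dsin2 mulr1.
Qed.

Lemma continuous_polar : continuous polar.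
Proof.
move=> p; have e1 : {for p, continuous (fun q : R * R => expR q.1)}.
  by apply: continuous_comp; [exact: cvg_fst|exact: continuous_expR].
have e2 : {for p, continuous (fun q : R * R => cos q.2)}.
  by apply: continuous_comp; [exact: cvg_snd|exact: continuous_cos].
have e3 : {for p, continuous (fun q : R * R => sin q.2)}.
  by apply: continuous_comp; [exact: cvg_snd|exact: continuous_sin].
exact: (continuous_pair (continuousM e1 e2) (continuousM e1 e3)).
Qed.

(* [Y p = I * X p] is the Cauchy-Riemann equation. *)
Lemma holo_of_partials F X Y p :
  {for p, continuous X} -> {for p, continuous Y} -> Y p = I * X p ->
  (forall q, F q - F p = (q.1 - p.1) *: X q + (q.2 - p.2) *: Y q) -> holomorphic_at I F p.
Proof.
move=> cX cY CR dF; apply: (@holo_of_small _ _ I2 _ _ (X p)) => e e0.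
have /cvgrPdist_lt/(_ (e / 2)) := cX; rewrite divr_gt0 // => /(_ isT) nX.
have /cvgrPdist_lt/(_ (e / 2)) := cY; rewrite divr_gt0 // => /(_ isT).
apply: filterS2 nX => q nX nY; rewrite dF.
rewrite [X in `|X|](_ : _ = (q.1 - p.1) *: (X q - X p) + (q.2 - p.2) *: (Y q - Y p)); last first.
  rewrite CR /slice_pt; move: (X q) (Y q) (X p) => x y z.
  by apply: quat_ext; rewrite !quatE /=; ring.
apply: le_trans (ler_normD _ _) _; rewrite !normrZ.
have h1 : `|q.1 - p.1| <= `|q - p| by rewrite prod_normE le_max lexx.
have h2 : `|q.2 - p.2| <= `|q - p| by rewrite prod_normE le_max lexx orbT.
rewrite [leRHS](_ : _ = `|q - p| * (e / 2) + `|q - p| * (e / 2)); last by field.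
by rewrite lerD // ler_pM // ltW // distrC.
Qed.

Lemma holo_polar p : holomorphic_at I (fun q => slice_pt I (polar q)) p.
Proof.
have /is_derive1_caratheodory [e [eE ec e0]] := is_derive_expR p.1.
have /is_derive1_caratheodory [c [cE cc c0]] := is_derive_cos p.2.
have /is_derive1_caratheodory [w [sE sc s0]] := is_derive_sin p.2.
have c1 (f : R -> R) : {for p.1, continuous f} -> {for p, continuous (fun q : R * R => f q.1)}.
  by move=> cf; apply: continuous_comp; [exact: cvg_fst|exact: cf].
have c2 (f : R -> R) : {for p.2, continuous f} -> {for p, continuous (fun q : R * R => f q.2)}.
  by move=> cf; apply: continuous_comp; [exact: cvg_snd|exact: cf].
(* The increment is split into a change of radius at the angle of [q] and a change of angle at the
   radius of [p]. *)
apply: (holo_of_partials (X := fun q => e q.1 *: slice_pt I (cos q.2, sin q.2))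
  (Y := fun q => expR p.1 *: slice_pt I (c q.2, w q.2))).
- apply: cvgZ; first exact: c1.
  apply: continuous_comp; last exact: continuous_slice_pt.
  by apply: continuous_pair; apply: c2; [exact: continuous_cos|exact: continuous_sin].
- apply: cvgZ; first exact: cvg_cst.
  apply: continuous_comp; last exact: continuous_slice_pt.
  by apply: continuous_pair; apply: c2.
- rewrite e0 c0 s0 -scalerAr; congr (_ *: _); rewrite /slice_pt /=.
  by rewrite mulrDr -!scalerAr mulr1 imag_unit_mul // scalerN scaleNr addrC.
- move=> q.
  have E1 : expR q.1 = expR p.1 + e q.1 * (q.1 - p.1) by rewrite -eE addrC subrK.
  have E2 : cos q.2 = cos p.2 + c q.2 * (q.2 - p.2) by rewrite -cE addrC subrK.
  have E3 : sin q.2 = sin p.2 + w q.2 * (q.2 - p.2) by rewrite -sE addrC subrK.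
  rewrite /slice_pt /polar /= E1 E2 E3.
  move: (expR p.1) (cos p.2) (sin p.2) (e q.1) (c q.2) (w q.2) (q.1 - p.1) (q.2 - p.2).
  by move=> *; apply: quat_ext; rewrite !quatE /=; ring.
Qed.

Lemma holo_comp_polar F p : holomorphic_at I F (polar p) -> holomorphic_at I (F \o polar) p.
Proof.
move=> [H [cH FH]]; have [K [cK PK]] := holo_polar p.
exists (fun q => K q * H (polar q)); split.
  apply: continuous_qmul => //; apply: continuous_comp; last exact: cH.
  exact: continuous_polar.
by move=> q; rewrite /= FH slice_ptB PK [X in X - _]addrC addrK mulrA.
Qed.

(** Integration against the angle: since dz = I z dt on the circle, this is the integral of dz / z
    up to the factor I. Constants therefore survive and give the mean value. *)
Definition circle_int F s : quat R := qint 0 (pi *+ 2) (fun t => F (polar (s, t))).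

Lemma polar2pi s : polar (s, pi *+ 2) = polar (s, 0).
Proof. by rewrite /polar /= cos2pi sin2pi cos0 sin0. Qed.

Definition clamp (c d x : R) := Num.max c (Num.min d x).

Lemma continuous_clamp c d : continuous (clamp c d).
Proof.
move=> x; apply: continuous_max; first exact: cvg_cst.
by apply: continuous_min; [exact: cvg_cst|exact: cvg_id].
Qed.

Lemma clamp_in c d x : c <= d -> c <= clamp c d x <= d.
Proof. by move=> cd; rewrite le_max lexx ge_max cd ge_min lexx. Qed.

Lemma clamp_id c d x : c <= x <= d -> clamp c d x = x.
Proof. by move=> /andP[cx xd]; rewrite /clamp (min_idPr xd) (max_idPr cx). Qed.

(** Goursat on the rectangle from [s1] to [s2] and from 0 to 2 pi: by periodicity the two sides at
    angles 0 and 2 pi cancel, and the remaining two are the circle integrals. *)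
Lemma circ_const F c d s1 s2 :
  (forall s t, c < s < d -> holomorphic_at I F (polar (s, t))) ->
  c < s1 -> s1 <= s2 -> s2 < d -> circle_int F s1 = circle_int F s2.
Proof.
move=> hF cs1 s12 s2d; pose c' := (c + s1) / 2; pose d' := (s2 + d) / 2.
have cc' : c < c' by rewrite /c'; lra.
have c's : c' < s1 by rewrite /c'; lra.
have d'd : d' < d by rewrite /d'; lra.
have sd' : s2 < d' by rewrite /d'; lra.
(* [goursat] asks for continuity on the whole plane, but [F] is controlled only for log radii
   between [c] and [d]. Freezing the radius outside the slightly larger interval from [c'] to [d']
   leaves the function unchanged near the rectangle. *)
pose G p := F (polar (clamp c' d' p.1, p.2)).
have pi2 : 0 <= pi *+ 2 :> R by rewrite mulrn_wge0 // pi_ge0.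
have hP p : c < p.1 < d -> holomorphic_at I (F \o polar) p.
  by move=> h; apply: holo_comp_polar; case: p h => s t; exact: hF.
have cG : continuous G.
  move=> p.
  have c1 : {for p, continuous (fun p : R * R => (clamp c' d' p.1, p.2))}.
    apply: continuous_pair; last exact: cvg_snd.
    by apply: continuous_comp; [exact: cvg_fst|exact: continuous_clamp].
  have c2 : {for (clamp c' d' p.1, p.2), continuous (F \o polar)}.
    apply: (@holo_continuous _ I); apply: hP => /=.
    have /andP[] : c' <= clamp c' d' p.1 <= d' by apply: clamp_in; lra.
    by move=> ? ?; apply/andP; split; lra.
  exact: (continuous_comp c1 c2).
have hG p : s1 <= p.1 <= s2 -> holomorphic_at I G p.
  move=> /andP[p1 p2]; apply: (holo_near I2 (F := F \o polar)); last first.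
    by apply: hP; apply/andP; split; lra.
  have h1 : \forall q \near p, c' < q.1.
    have /cvgr_gt/(_ c') : {for p, continuous (fun q : R * R => q.1)} by exact: cvg_fst.
    by apply; lra.
  have h2 : \forall q \near p, q.1 < d'.
    have /cvgr_lt/(_ d') : {for p, continuous (fun q : R * R => q.1)} by exact: cvg_fst.
    by apply; lra.
  apply: filterS2 h1 h2 => q q1 q2 /=.
  by rewrite /G clamp_id ?(ltW q1) ?(ltW q2) //; case: q {q1 q2}.
have := @goursat R I I2 G s1 s2 0 (pi *+ 2) cG s12 pi2 (fun p h _ => hG p h).
rewrite /boundary_int /G /= !clamp_id; try (by apply/andP; split; lra).
rewrite (_ : qint s1 s2 _ = qint s1 s2 (fun s => F (polar (clamp c' d' s, 0)))); last first.
  by apply: eq_qint => s _; rewrite polar2pi.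
rewrite subrr subr0.
change (I * (circle_int F s2 - circle_int F s1) = 0 -> circle_int F s1 = circle_int F s2).
move: (circle_int F s1) (circle_int F s2) => u v /(congr1 Num.norm).
rewrite qnormM imag_unit_norm // mul1r normr0 => /eqP.
by rewrite normr_eq0 subr_eq0 => /eqP.
Qed.

End Circles.

(** * The mean value property, with one exceptional circle allowed *)

Section MeanValue.
Variables (R : realType) (I : quat R).
Hypothesis I2 : imag_units R I.
Implicit Types (F G : R * R -> quat R) (p q : R * R) (s t e : R).

(** Compactness of the segment makes the closeness uniform in [t]. *)
Lemma near_on_segment (g : R * R -> quat R) s0 a b e :
  (forall t, {for (s0, t), continuous g}) -> 0 < e ->
  \forall s \near s0, forall t, a <= t <= b -> `|g (s, t) - g (s0, t)| < e.
Proof.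
move=> cg e0; have /compact_near_coveringP K := @segment_compact R a b.
pose P s t := `|g (s, t) - g (s0, t)| < e.
suff cov t : `[a, b]%classic t -> \forall t' \near t & s \near nbhs s0, P s t'.
  apply: filterS (K R (nbhs s0) P (nbhs_filter s0) cov) => s sub t tab.
  by apply: sub => /=; rewrite in_itv.
move=> _; rewrite /P.
have e2 : 0 < e / 2 by rewrite divr_gt0.
have /cvgrPdist_lt/(_ _ e2)[[B1 B2] /= [n1 n2] BP] := cg t.
exists (B2, B1) => // -[t' s] /= [t'B sB].
have h1 := BP (s, t') (conj sB t'B).
have h2 := BP (s0, t') (conj (nbhs_singleton n1) t'B).
have -> : g (s, t') - g (s0, t') = (g (s0, t) - g (s0, t')) - (g (s0, t) - g (s, t')).
  by rewrite opprB [RHS]addrC addrA subrK.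
apply: le_lt_trans (ler_normB _ _) _; rewrite /= in h1 h2.
by rewrite [e](_ : _ = e / 2 + e / 2) ?ltrD //; field.
Qed.

Lemma continuous_on_circle F s :
  (forall p, `|slice_pt I p| < 1 -> {for p, continuous F}) -> s < 0 ->
  continuous (fun t => F (polar (s, t))).
Proof.
move=> cF s0 t; apply: (@continuous_comp _ _ _ (fun t : R => polar (s, t)) F).
  apply: (@continuous_comp _ _ _ (fun t : R => (s, t)) (@polar R)).
    by apply: continuous_pair; [exact: cvg_cst|exact: cvg_id].
  exact: continuous_polar.
by apply: cF; rewrite slice_pt_polar_norm // expR_lt1.
Qed.

Lemma circ_near F s0 e :
  (forall p, `|slice_pt I p| < 1 -> {for p, continuous F}) -> s0 < 0 -> 0 < e ->
  \forall s \near s0, `|circle_int F s - circle_int F s0| <= e.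
Proof.
move=> cF s00 e0; have pi0 := pi_gt0 R.
have E (z : R) : 0 < z -> 4 * (z *+ 2 - 0) * (e / (8 * z)) = e.
  by move=> z0; field; rewrite gt_eqF.
have e1 : 0 < e / (8 * pi) by rewrite divr_gt0 // mulr_gt0.
have := @near_on_segment (F \o (@polar R)) s0 0 (pi *+ 2) (e / (8 * pi)) _ e1.
have cP t : {for (s0, t), continuous (F \o (@polar R))}.
  apply: continuous_comp; first exact: continuous_polar.
  by apply: cF; rewrite slice_pt_polar_norm // expR_lt1.
move=> /(_ cP); apply: filterS2 (lt_nbhsl s00) => s s0' near.
rewrite /circle_int -qintB; try exact: continuous_on_circle.
apply: le_trans (qint_norm_le (e := e / (8 * pi)) _ _ _) _.
- by move=> t; apply: cvgB; exact: continuous_on_circle.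
- by rewrite mulrn_wge0 // ltW.
- by move=> t h; exact: ltW (near t h).
- by rewrite E // pi_gt0.
Qed.

Lemma near_pick_right (P : R -> Prop) s0 d : s0 < d -> (\forall s \near s0, P s) ->
  exists2 s, s0 < s < d & P s.
Proof.
move=> s0d /nbhs_ballP[r /= r0 rP]; exists (s0 + Num.min (r / 2) ((d - s0) / 2)).
  rewrite ltrDl lt_min !divr_gt0 ?subr_gt0 //=.
  by have : Num.min (r / 2) ((d - s0) / 2) <= (d - s0) / 2; [rewrite ge_min lexx orbT|lra].
apply: rP; rewrite /ball /= opprD addrA subrr sub0r normrN ger0_norm.
  by apply: (@le_lt_trans _ _ (r / 2)); [rewrite ge_min lexx|lra].
by rewrite le_min !divr_ge0 ?subr_ge0 // ltW.
Qed.

Lemma near_pick_left (P : R -> Prop) s0 : (\forall s \near s0, P s) ->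
  exists2 s, s < s0 & P s.
Proof.
move=> /nbhs_ballP[r /= r0 rP]; exists (s0 - r / 2); first by lra.
by apply: rP; rewrite /ball /= opprB addrC subrK ger0_norm; lra.
Qed.

(** Differentiability may fail on the circle of log radius [s0] and at the centre, where continuity
    suffices. The circle integral is constant on either side of [s0], continuity glues the two
    values, and shrinking circles identify the constant. This is made for difference quotients,
    which are only known to be continuous at their base point. *)
Lemma circ_mean_value F s0 s : s0 < s -> s < 0 ->
  (forall p, `|slice_pt I p| < 1 -> {for p, continuous F}) ->
  (forall s t, s < 0 -> s != s0 -> holomorphic_at I F (polar (s, t))) ->
  circle_int F s = (pi *+ 2) *: F 0.
Proof.
move=> s0s s1 cF hF; have s00 := lt_trans s0s s1.
have pi0 := pi_gt0 R.
have right s' : s0 < s' < 0 -> circle_int F s' = circle_int F s.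
  move=> /andP[h1 h2]; have hh u v : s0 < u < 0 -> holomorphic_at I F (polar (u, v)).
    by move=> /andP[u1 u2]; apply: hF; rewrite // gt_eqF.
  have [le|lt] := leP s s'; first by apply/esym/(circ_const I2 hh).
  by apply: (circ_const I2 hh); rewrite // ltW.
have left s' s'' : s' <= s'' -> s'' < s0 -> circle_int F s' = circle_int F s''.
  move=> h1 h2; apply: (@circ_const _ _ I2 F (s' - 1) s0) => //; last by lra.
  move=> u v /andP[u1 u2]; apply: hF; first exact: lt_trans u2 _.
  by rewrite lt_eqF.
apply/eqP; rewrite -subr_eq0 -normr_le0; apply/ler_addgt0Pr => e e0; rewrite add0r.
have e4 : 0 < e / 4 by rewrite divr_gt0.
have near0 := circ_near cF s00 e4.
(* One circle on each side of [s0], both with integrals within [e / 4] of the integral at [s0]. *)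
have [s' /right <- n1] := near_pick_right s00 near0.
have [s2 s2s n2] := near_pick_left near0.
have e5 : 0 < e / (16 * pi) by rewrite divr_gt0 // mulr_gt0.
have cF0 : {for 0, continuous F}.
  by apply: cF; rewrite /slice_pt /= !scale0r addr0 normr0.
have /cvgrPdist_lt/(_ _ e5) /nbhs_ballP[r /= r0 rP] := cF0.
(* Small enough to stay on the inner side of [s0] and to have its circle in the ball where [F] is
   close to its value at 0. *)
pose s3 := Num.min s2 (ln (r / 2)).
have s32 : s3 <= s2 by rewrite ge_min lexx.
have es3 : expR s3 < r.
  apply: (@le_lt_trans _ _ (expR (ln (r / 2)))).
    by rewrite ler_expR ge_min lexx orbT.
  rewrite lnK; last by rewrite posrE divr_gt0.
  by rewrite ltr_pdivrMr // ltr_pMr // ltr1n.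
have E (z : R) : 0 < z -> 4 * (z *+ 2) * (e / (16 * z)) = e / 2.
  by move=> z0; field; rewrite gt_eqF.
have n3 : `|circle_int F s3 - (pi *+ 2) *: F 0| <= e / 2.
  have := @qint_near R 0 (pi *+ 2) (e / (16 * pi)) (F 0) (fun t => F (polar (s3, t))).
  rewrite subr0 => /(_ _ _ _) H; apply: le_trans (H _ _ _) _.
  - exact: (continuous_on_circle cF (le_lt_trans s32 (lt_trans s2s s00))).
  - by rewrite mulrn_wge0 // ltW.
  - move=> t _; rewrite distrC ltW //; apply: rP; rewrite -ball_normE /= sub0r normrN.
    apply: le_lt_trans es3; rewrite -(slice_pt_polar_norm I2 (s3, t)).
    exact: slice_pt_norm_ge.
  - by rewrite E // pi_gt0.
rewrite (left _ _ s32 s2s) in n3.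
rewrite [X in `|X|](_ : _ = (circle_int F s' - circle_int F s0) - (circle_int F s2 - circle_int F s0) +
  (circle_int F s2 - (pi *+ 2) *: F 0)); last first.
  move: (circle_int F s') (circle_int F s0) (circle_int F s2) ((pi *+ 2) *: F 0) => u v w z.
  by apply: quat_ext; rewrite !quatE /=; ring.
apply: le_trans (ler_normD _ _) _.
rewrite [leRHS](_ : _ = (e / 4 + e / 4) + e / 2); last by field.
by apply: lerD n3; exact: le_trans (ler_normB _ _) (lerD n1 n2).
Qed.

End MeanValue.

Lemma qinvZ (R : realType) (a : R) (q : quat R) : a != 0 -> qinv (a *: q) = a^-1 *: qinv q.
Proof.
move=> a0; rewrite /qinv normrZ exprMn real_normK ?num_real // invfM.
have -> : qconj (a *: q) = a *: qconj q.
  by apply: quat_ext; rewrite /qconj !quatE /=; ring.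
by rewrite !scalerA; congr (_ *: _); move: (`|q| ^- 2) => N; field.
Qed.

(** * Taylor expansion on a slice *)

Section Taylor.
Variables (R : realType) (I : quat R).
Hypothesis I2 : imag_units R I.
Implicit Types (F G : R * R -> quat R) (p q w : R * R) (s t e : R).
Local Notation z := (slice_pt I).

Lemma holo_mul_slice_pt F p : holomorphic_at I F p -> holomorphic_at I (fun q => z q * F q) p.
Proof.
by move=> hF; apply: (holoM (A := z)) => //; [move=> q; exact: slice_ptC|exact: holo_slice_pt].
Qed.

Lemma holo_mulX F n p : holomorphic_at I F p -> holomorphic_at I (fun q => z q ^+ n * F q) p.
Proof.
elim: n F => [|n IH] F hF.
  by rewrite (_ : (fun q => _) = F) //; apply/funext => q; rewrite expr0 mul1r.
rewrite (_ : (fun q => _) = (fun q => z q ^+ n * (z q * F q))).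
  exact/IH/holo_mul_slice_pt.
by apply/funext => q; rewrite exprSr mulrA.
Qed.

Lemma holo_mulV F w p : p != w -> holomorphic_at I F p ->
  holomorphic_at I (fun q => qinv (z (q - w)) * F q) p.
Proof.
move=> pw hF; apply: (holoM (A := fun q => qinv (z (q - w)))) => //.
  by move=> q; exact: slice_pt_qinvC.
exact: holo_qinv.
Qed.

Lemma holo_mulXV F n p : p != 0 -> holomorphic_at I F p -> holomorphic_at I (fun q => qinv (z q) ^+ n * F q) p.
Proof.
move=> p0; elim: n F => [|n IH] F hF.
  by rewrite (_ : (fun q => _) = F) //; apply/funext => q; rewrite expr0 mul1r.
rewrite (_ : (fun q => _) = (fun q => qinv (z q) ^+ n * (qinv (z (q - 0)) * F q))).
  exact/IH/holo_mulV.
by apply/funext => q; rewrite exprSr subr0 mulrA.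
Qed.

Lemma polar_neq0 p : polar p != 0.
Proof.
by rewrite -(slice_pt_eq0 I2) -normr_eq0 slice_pt_polar_norm // gt_eqF // expR_gt0.
Qed.

Lemma continuous_circle F s : (forall t, {for polar (s, t), continuous F}) ->
  continuous (fun t => F (polar (s, t))).
Proof.
move=> cF t; apply: (@continuous_comp _ _ _ (fun t : R => polar (s, t)) F); last exact: cF.
apply: (@continuous_comp _ _ _ (fun t : R => (s, t)) (@polar R)).
  by apply: continuous_pair; [exact: cvg_cst|exact: cvg_id].
exact: continuous_polar.
Qed.

Lemma circ_const2 F d s1 s2 :
  (forall s t, s < d -> holomorphic_at I F (polar (s, t))) -> s1 < d -> s2 < d ->
  circle_int F s1 = circle_int F s2.
Proof.
move=> hF; wlog le12 : s1 s2 / s1 <= s2.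
  move=> H h1 h2; have [le|lt] := leP s1 s2; first exact: H.
  by apply/esym/H => //; exact: ltW.
move=> _ h2; apply: (@circ_const _ _ I2 F (s1 - 1) d) => //; last by lra.
by move=> s t /andP[_]; exact: hF.
Qed.

Lemma circ_cst u s : circle_int (fun=> u) s = (pi *+ 2) *: u.
Proof. by rewrite /circle_int qint_cst ?subr0 // mulrn_wge0 // pi_ge0. Qed.

(** The integral does not depend on the radius, yet passing from radius 1 to radius [expR 1]
    multiplies it by [expR 1 ^- n.+1], which is less than 1. *)
Lemma circ_negative_power n s : circle_int (fun q => qinv (z q) ^+ n.+1) s = 0.
Proof.
pose g q := qinv (z q) ^+ n.+1; rewrite -/g.
have hg t t' : holomorphic_at I g (polar (t, t')).
  rewrite (_ : g = fun q => qinv (z q) ^+ n.+1 * 1); last first.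
    by apply/funext => q; rewrite mulr1.
  by apply: holo_mulXV; [exact: polar_neq0|exact: holo_cst].
have cg t : continuous (fun t' => g (polar (t, t'))).
  by apply: continuous_circle => t'; exact: holo_continuous (hg _ _).
have E t : circle_int g t = circle_int g 0.
  have tm : t < Num.max t 0 + 1 by rewrite ltr_pwDr // le_max lexx.
  have t0 : 0 < Num.max t 0 + 1 by rewrite ltr_pwDr // le_max lexx orbT.
  by apply: (@circ_const2 g (Num.max t 0 + 1)) => // *; exact: hg.
rewrite E; have : circle_int g 1 = (expR 1 ^- n.+1)%:A * circle_int g 0.
  rewrite /circle_int -qint_mull //; apply: eq_qint => t _; rewrite /g.
  have -> : z (polar (1, t)) = expR 1 *: z (polar (0, t)).
    by apply: quat_ext; rewrite /slice_pt /polar !quatE /= expR0; ring.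
  by rewrite qinvZ ?gt_eqF ?expR_gt0 // exprZn exprVn -scalerAl mul1r.
rewrite E => /(congr1 Num.norm); rewrite qnormM normrZ qnorm1 mulr1.
move/eqP; rewrite -subr_eq0 -{1}[`|circle_int g 0|]mul1r -mulrBl mulf_eq0.
rewrite normr_eq0 subr_eq0 => /orP[/eqP E1|/eqP //].
have : expR 1 ^- n.+1 < 1 :> R.
  by rewrite invf_lt1 ?exprn_gt0 ?expR_gt0 // exprn_egt1 // expR_gt1.
by rewrite -[X in X < _]ger0_norm ?invr_ge0 ?exprn_ge0 ?expR_ge0 // -E1 ltxx.
Qed.

End Taylor.

Section TaylorCoefficients.
Variables (R : realType) (I : quat R) (F : R * R -> quat R).
Hypothesis I2 : imag_units R I.
Local Notation z := (slice_pt I).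
Hypothesis hF : forall p, `|z p| < 1 -> holomorphic_at I F p.
Implicit Types (p q w : R * R) (s t e : R).

(** Cauchy's formula for the coefficient, on the circle of radius [expR (-1)]. Any radius below 1
    gives the same value by [circ_taylor_coef]; this one leads to the growth rate [expR 1] in
    [slice_taylor_bound]. *)
Definition taylor_coef k : quat R :=
  (pi *+ 2)^-1 *: circle_int (fun q => qinv (z q) ^+ k * F q) (-1).

Lemma polar_in_disc s t : s < 0 -> `|z (polar (s, t))| < 1.
Proof. by move=> s0; rewrite slice_pt_polar_norm // expR_lt1. Qed.

Lemma slice_pt0 : z 0 = 0. Proof. by rewrite /slice_pt /= !scale0r addr0. Qed.

Lemma pi2_neq0 : pi *+ 2 != 0 :> R.
Proof. by rewrite mulrn_eq0 /= gt_eqF // pi_gt0. Qed.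

Lemma circ_taylor_coef k s : s < 0 ->
  circle_int (fun q => qinv (z q) ^+ k * F q) s = (pi *+ 2) *: taylor_coef k.
Proof.
move=> s0; rewrite /taylor_coef scalerA divff ?pi2_neq0 // scale1r.
apply: (circ_const2 I2 (d := 0)) => //.
move=> t u t0; apply: holo_mulXV => //; first exact: (polar_neq0 I2).
by apply: hF; exact: polar_in_disc.
Qed.

Lemma circ_positive_power n s : s < 0 -> circle_int (fun q => z q ^+ n.+1 * F q) s = 0.
Proof.
move=> s0; have hX p : `|z p| < 1 -> holomorphic_at I (fun q => z q ^+ n.+1 * F q) p.
  by move=> ?; apply: holo_mulX => //; exact: hF.
(* No circle is exceptional here, so [s - 1] is an arbitrary smaller log radius; the function
   vanishes at the centre. *)
rewrite (@circ_mean_value _ _ I2 _ (s - 1)) //; first last.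
- by move=> t u t0 _; apply: hX; exact: polar_in_disc.
- by move=> p p1; exact: holo_continuous (hX _ p1).
- lra.
by rewrite slice_pt0 expr0n mul0r scaler0.
Qed.

(** [s0] is the log radius of the circle through [w]. No circle passes through 0, so for [w = 0] the
    value -1 is arbitrary. *)
Lemma radius_avoiding w : `|z w| < 1 -> exists s0 : R,
  [/\ s0 < 0, `|z w| <= expR s0 & forall s t, s != s0 -> polar (s, t) != w].
Proof.
move=> w1; have [->|w0] := eqVneq w 0.
  exists (-1); split; [by rewrite oppr_lt0|by rewrite slice_pt0 normr0 expR_ge0|].
  by move=> s t _; exact: (polar_neq0 I2).
have zw0 : 0 < `|z w| by rewrite normr_gt0 slice_pt_eq0.
exists (ln `|z w|); split; first by rewrite ln_lt0 // zw0.
  by rewrite lnK.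
move=> s t ss0; apply: contra ss0 => /eqP <-.
by rewrite slice_pt_polar_norm //= expRK.
Qed.

(** The quotient [H] of F q - F w by q - w is continuous even at [w], so q H q, which vanishes at 0,
    has circle integral 0. Expanding the quotient geometrically in w / q leaves the Taylor
    polynomial and a remainder of order [rho ^+ N.+1]. The circle of log radius [s0 / 2] lies
    strictly between [w] and the unit circle. *)
Lemma taylor_estimate w : `|z w| < 1 -> (forall p, `|z p| < 1 -> `|F p| <= 1) ->
  exists C rho : R, [/\ 0 <= rho, rho < 1 &
    forall N, `|F w - \sum_(k < N.+1) z w ^+ k * taylor_coef k| <= C * rho ^+ N.+1].
Proof.
move=> w1 bF; have [s0 [s00 ws0 avoid]] := radius_avoiding w1.
have hFw := hF w1; have [H [cH FH]] := hFw.
pose D q := F q - F w; pose s := s0 / 2; pose r := expR s; pose rho := `|z w| / r.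
have s0s : s0 < s by rewrite /s; lra.
have s1 : s < 0 by rewrite /s; lra.
have r0 : 0 < r by exact: expR_gt0.
have wr : `|z w| < r by apply: le_lt_trans ws0 _; rewrite ltr_expR.
have hD p : `|z p| < 1 -> holomorphic_at I D p.
  by move=> p1; apply: holoD; [exact: hF|exact: holo_cst].
have DH q : D q = z (q - w) * H q by rewrite /D FH addrC addKr.
have hH p : `|z p| < 1 -> p != w -> holomorphic_at I H p.
  move=> p1 pw; apply: (holo_near I2 (F := fun q => qinv (z (q - w)) * D q)).
    have /cvgr_neq0 : {for p, continuous (fun q : R * R => q - w)}.
      by apply: cvgB; [exact: cvg_id|exact: cvg_cst].
    rewrite subr_eq0 => /(_ pw); apply: filterS => q qw.
    by rewrite DH mulrA mul_qVq ?mul1r // slice_pt_eq0.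
  by apply: holo_mulV => //; exact: hD.
have cH1 p : `|z p| < 1 -> {for p, continuous H}.
  by move=> p1; have [->|pw] := eqVneq p w; [exact: cH|exact: holo_continuous (hH _ _ _)].
have cG : circle_int (fun q => z q * H q) s = 0.
  rewrite (circ_mean_value I2 s0s s1); first by rewrite slice_pt0 mul0r scaler0.
    move=> p p1; apply: continuous_qmul; last exact: cH1.
    exact: continuous_slice_pt.
  move=> t u t0 ts0; apply: holo_mul_slice_pt => //; apply: hH; last exact: avoid.
  exact: polar_in_disc.
have zs0 t : z (polar (s, t)) != 0 by rewrite slice_pt_eq0 // (polar_neq0 I2).
(* Iteration of [z q * H q = D q + z w * H q]. *)
have kernel N q : z q != 0 -> z q * H q =
    \sum_(k < N) z w ^+ k * (qinv (z q) ^+ k * D q) +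
    z w ^+ N * (qinv (z q) ^+ N * (z q * H q)).
  move=> zq0; elim: N => [|N IH].
    by rewrite big_ord0 add0r !expr0 !mul1r.
  rewrite {1}IH big_ord_recr /= -addrA; congr (_ + _).
  have zwC : qinv (z q) ^+ N * z w = z w * qinv (z q) ^+ N.
    by apply/esym/commrX; exact: slice_pt_qinvC.
  have -> : qinv (z q) ^+ N.+1 * (z q * H q) = qinv (z q) ^+ N * H q.
    by rewrite exprSr -mulrA [qinv _ * _]mulrA mul_qVq // mul1r.
  have -> : z q * H q = D q + z w * H q.
    by rewrite DH slice_ptB mulrBl subrK.
  by rewrite !mulrDr [z w ^+ N.+1]exprSr -!mulrA [z w * (_ * _)]mulrA -zwC !mulrA.
have cD k : continuous (fun t => qinv (z (polar (s, t))) ^+ k * D (polar (s, t))).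
  apply: (continuous_circle (F := fun q => qinv (z q) ^+ k * D q)) => t.
  apply: (@holo_continuous _ I); apply: holo_mulXV => //; first exact: (polar_neq0 I2).
  by apply: hD; exact: polar_in_disc.
have cV N t : {for polar (s, t), continuous (fun q => qinv (z q) ^+ N)}.
  have := @holo_mulXV _ _ I2 (fun=> 1) N _ (polar_neq0 I2 (s, t)) (holo_cst _ _ _).
  move=> /holo_continuous; rewrite (_ : (fun q => _) = fun q => qinv (z q) ^+ N) //.
  by apply/funext => q; rewrite mulr1.
have cml u (G : R -> quat R) : continuous G -> continuous (fun t => u * G t).
  move=> cG' t; apply: (@continuous_qmul _ _ (fun=> u) G); last exact: cG'.
  exact: cvg_cst.
pose E N q := qinv (z q) ^+ N * (z q * H q).
have cE N : continuous (fun t => E N (polar (s, t))).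
  apply: (continuous_circle (F := E N)) => t.
  apply: continuous_qmul; first exact: cV.
  apply: continuous_qmul; first exact: continuous_slice_pt.
  by apply: cH1; exact: polar_in_disc.
(* Subtracting the constant [F w] changes only the coefficient of index 0, because negative powers
   integrate to 0. *)
have circD k : circle_int (fun q => qinv (z q) ^+ k * D q) s =
    (pi *+ 2) *: taylor_coef k - (if k == 0%N then (pi *+ 2) *: F w else 0).
  rewrite -(circ_taylor_coef k s1).
  have -> : (if k == 0%N then (pi *+ 2) *: F w else 0) =
      circle_int (fun q => qinv (z q) ^+ k) s * F w.
    case: k => [|k] /=; last by rewrite circ_negative_power // mul0r.
    under [X in circle_int X]eq_fun do rewrite expr0.
    by rewrite circ_cst -scalerAl mul1r.
  have cVF : continuous (fun t => qinv (z (polar (s, t))) ^+ k * F (polar (s, t))).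
    apply: (continuous_circle (F := fun q => qinv (z q) ^+ k * F q)) => t.
    apply: continuous_qmul; first exact: cV.
    by apply: (@holo_continuous _ I); apply: hF; exact: polar_in_disc.
  have cVk : continuous (fun t => qinv (z (polar (s, t))) ^+ k).
    by apply: (continuous_circle (F := fun q => qinv (z q) ^+ k)) => t; exact: cV.
  rewrite /circle_int -qint_mulr // -qintB //.
    by apply: eq_qint => t _; rewrite -mulrBr.
  move=> t; apply: (@continuous_qmul _ _ (fun t => qinv (z (polar (s, t))) ^+ k)) => //.
    exact: cVk.
  exact: cvg_cst.
have main N : (pi *+ 2) *: (F w - \sum_(k < N.+1) z w ^+ k * taylor_coef k) =
    z w ^+ N.+1 * circle_int (E N.+1) s.
  have : circle_int (fun q => z q * H q) s =
      \sum_(k < N.+1) z w ^+ k * circle_int (fun q => qinv (z q) ^+ k * D q) s +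
      z w ^+ N.+1 * circle_int (E N.+1) s.
    have cwD (k : 'I_N.+1) : continuous (fun t =>
        z w ^+ k * (qinv (z (polar (s, t))) ^+ k * D (polar (s, t)))).
      by apply: cml; exact: cD.
    rewrite {2}/circle_int -qint_mull; last exact: cE.
    under eq_bigr => k _ do (rewrite /circle_int -qint_mull; last exact: cD).
    rewrite -qint_sum // -qintD.
    - by apply: eq_qint => t _; exact: kernel.
    - exact: continuous_qsum.
    - by apply: cml; exact: cE.
  rewrite cG; under eq_bigr => k _ do rewrite circD mulrBr -scalerAr.
  have S0 : \sum_(k < N.+1) z w ^+ k * (if k == 0%N :> nat then (pi *+ 2) *: F w else 0) =
      (pi *+ 2) *: F w.
    rewrite big_ord_recl /= expr0 mul1r big1 ?addr0 // => k _.
    by rewrite mulr0.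
  rewrite sumrB -scaler_sumr S0 => /eqP; rewrite eq_sym addr_eq0 => /eqP E0.
  by rewrite scalerBr -[RHS]opprK -E0 opprB.
(* On the circle [D] is at most 2, as [F] is bounded by 1, and the distance to [w] is at least
   [r - |w|]; this bounds [H]. *)
have EN N : `|circle_int (E N) s| <= 4 * (pi *+ 2 - 0) * (r ^- N * (r * (2 / (r - `|z w|)))).
  apply: qint_norm_le => //; first by rewrite mulrn_wge0 // pi_ge0.
  move=> t _; set q := polar (s, t).
  have zq : `|z q| = r by rewrite slice_pt_polar_norm.
  have q1 : `|z q| < 1 by exact: polar_in_disc.
  rewrite /E !qnormM qnormX qnorm_inv zq exprVn.
  rewrite ler_pM2l ?invr_gt0 ?exprn_gt0 // ler_pM2l //.
  rewrite ler_pdivlMr ?subr_gt0 // mulrC.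
  apply: (@le_trans _ _ `|D q|).
    rewrite DH qnormM ler_wpM2r // slice_ptB.
    by apply: le_trans (lerB_dist _ _); rewrite zq.
  apply: le_trans (ler_normB _ _) _.
  by rewrite [2](_ : _ = 1 + 1) // lerD // bF.
exists (4 * (r * (2 / (r - `|z w|)))), rho; split.
- by rewrite divr_ge0 // ltW.
- by rewrite ltr_pdivrMr // mul1r.
move=> N; have pi0 := pi_gt0 R.
have p20 : 0 < pi *+ 2 :> R by rewrite mulrn_wgt0.
rewrite -(ler_pM2l p20) -{1}[pi *+ 2]gtr0_norm // -normrZ main qnormM qnormX.
apply: le_trans (ler_wpM2l _ (EN _)) _; first by rewrite exprn_ge0.
rewrite le_eqVlt; apply/orP; left; apply/eqP; rewrite /rho expr_div_n subr0.
by move: (r ^- N.+1) (`|z w| ^+ N.+1) (pi *+ 2) (r * _) => x y p v; ring.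
Qed.

End TaylorCoefficients.

(** * Slice regularity as complex differentiability; uniqueness of power series *)

Section SliceRegular.
Variable R : realType.
Implicit Types (I J u : quat R) (f : quat R -> quat R) (p q w : R * R).

(** The Cauchy-Riemann equation says that the real differential multiplies ['D_(1, 0) F p] on the
    left by the increment read in the slice. *)
Lemma holo_differentiable I (F : R * R -> quat R) p : imag_units R I ->
  differentiable F p -> 'D_(1, 0) F p + I * 'D_(0, 1) F p = 0 -> holomorphic_at I F p.
Proof.
move=> I2 dF CR; have := diff_locally dF => /eqaddoP small.
have D01 : 'D_(0, 1) F p = I * 'D_(1, 0) F p.
  move/eqP: CR; rewrite addr_eq0 => /eqP ->.
  by rewrite mulrN mulrA imag_unit_mul // mulN1r opprK.
apply: (@holo_of_small _ _ I2 _ _ ('D_(1, 0) F p)) => e e0.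
have /nbhs_ballP[r /= r0 rP] := small e e0.
apply/nbhs_ballP; exists r => //= q pq.
have /rP : ball (0 : R * R) r (q - p).
  by move: pq; rewrite -!ball_normE /= sub0r normrN distrC.
have E : (F \o shift p) (q - p) = F q by rewrite /= subrK.
change (`|(F \o shift p) (q - p) - (F p + 'd F p (q - p))| <= e * `|q - p| ->
  `|F q - F p - slice_pt I (q - p) * 'D_(1, 0) F p| <= e * `|q - p|).
rewrite E opprD addrA; congr (`|_ - _| <= _).
have -> : q - p = (q.1 - p.1) *: (1, 0) + (q.2 - p.2) *: (0, 1).
  rewrite [LHS]surjective_pairing; congr pair; rewrite /= /GRing.scale /=; ring.
rewrite linearD !linearZ /= -!deriveE // D01 /slice_pt /= mulrDl -!scalerAl mul1r.
by congr (_ *: _ + _ *: _); rewrite /GRing.scale /=; ring.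
Qed.

Lemma slice_regular_holo f I p : slice_regular (unit_ball R) f -> imag_units R I ->
  `|slice_pt I p| < 1 -> holomorphic_at I (f \o slice_pt I) p.
Proof.
move=> freg I2 p1; case: p p1 => x y p1.
have [dF /eqP] := freg I I2 x y p1.
rewrite scaler_eq0 invr_eq0 pnatr_eq0 /= => /eqP; exact: holo_differentiable.
Qed.

Lemma geometric_half_le (y : R) n : 0 <= y -> y <= 2^-1 -> \sum_(i < n) y ^+ i <= 2 - 2 * y ^+ n.
Proof.
move=> y0 y1; elim: n => [|n IH]; first by rewrite big_ord0 expr0 mulr1 subrr.
rewrite big_ord_recr /=; apply: le_trans (lerD IH (lexx _)) _.
have : y ^+ n.+1 <= y ^+ n * 2^-1 by rewrite exprSr ler_wpM2l // exprn_ge0.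
lra.
Qed.

(** By induction the terms below [k] vanish. Once divided by x^k, the terms above [k] are at most a
    constant times x as long as x M <= 1/2, so [b k] is as small as x. *)
Lemma power_series_zero (b : nat -> quat R) (M C : R) : 1 <= M -> 0 <= C ->
  (forall k, `|b k| <= C * M ^+ k) ->
  (forall x : R, 0 < x < 1 -> (fun n => \sum_(k < n) x ^+ k *: b k) @ \oo --> (0 : quat R)) ->
  forall k, b k = 0.
Proof.
move=> M1 C0 bM b0; elim/ltn_ind => k IH; apply/eqP; rewrite -normr_le0.
have M0 : 0 < M by exact: lt_le_trans ltr01 M1.
have small x : 0 < x -> x * M <= 2^-1 -> `|b k| <= 2 * C * M ^+ k.+1 * x.
  move=> x0 xM; have xk : 0 < x ^+ k by rewrite exprn_gt0.
  have x1 : x < 1.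
    apply: le_lt_trans (_ : x * M < 1); first by rewrite ler_pMr // ltW.
    by apply: le_lt_trans xM _; rewrite invf_lt1 // ltr1n.
  rewrite -(ler_pM2l xk).
  apply/ler_addgt0Pr => e e0.
  have /cvgrPdist_le/(_ e e0) [n _ nP] := b0 x (introT andP (conj x0 x1)).
  have := nP (k.+1 + n)%N (leq_addl _ _); rewrite /= sub0r normrN.
  rewrite big_split_ord /= big_ord_recr /= big1 ?add0r; last first.
    by move=> i _; rewrite IH // scaler0.
  set T := \sum_(i < n) _ => le1.
  have le2 : `|T| <= x ^+ k * (2 * C * M ^+ k.+1 * x).
    rewrite /T; apply: le_trans (ler_norm_sum _ _ _) _.
    apply: (@le_trans _ _ (\sum_(i < n) C * (x * M) ^+ k.+1 * (x * M) ^+ i)).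
      apply: ler_sum => i _; rewrite normrZ ger0_norm ?exprn_ge0 ?(ltW x0) //.
      apply: le_trans (ler_wpM2l _ (bM _)) _; first by rewrite exprn_ge0 ?(ltW x0).
      by rewrite -mulrA -exprD mulrCA exprMn.
    rewrite -mulr_sumr.
    have xM0 : 0 <= x * M by rewrite mulr_ge0 // ltW.
    have := geometric_half_le n xM0 xM => le3.
    have le4 : \sum_(i < n) (x * M) ^+ i <= 2.
      by apply: le_trans le3 _; rewrite gerBl mulr_ge0 // exprn_ge0.
    apply: le_trans (ler_wpM2l _ le4) _.
      by rewrite mulr_ge0 // exprn_ge0.
    by rewrite exprMn exprSr le_eqVlt; apply/orP; left; apply/eqP; ring.
  have -> : x ^+ k * `|b k| = `|(x ^+ k *: b k + T) - T|.
    by rewrite addrK normrZ ger0_norm // ltW.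
  by apply: le_trans (ler_normB _ _) _; rewrite addrC lerD.
apply/ler_addgt0Pr => e e0; rewrite add0r.
pose K := 2 * C * M ^+ k.+1; have K0 : 0 <= K by rewrite !mulr_ge0 // exprn_ge0 // ltW.
(* The first bound gives x M <= 1/2, the second K x <= e; [K + 1] is positive even when [K] is 0. *)
pose x := Num.min ((2 * M)^-1) (e / (K + 1)).
have x0 : 0 < x by rewrite lt_min invr_gt0 mulr_gt0 // divr_gt0 // ltr_wpDl.
apply: le_trans (small x x0 _) _.
  apply: (@le_trans _ _ ((2 * M)^-1 * M)); first by rewrite ler_pM2r // ge_min lexx.
  by rewrite invfM mulfVK // gt_eqF.
apply: (@le_trans _ _ (K * (e / (K + 1)))).
  by rewrite ler_wpM2l // ge_min lexx orbT.
rewrite mulrCA ler_piMr ?(ltW e0) // ler_pdivrMr ?ltr_wpDl // mul1r lerDl //.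
Qed.

End SliceRegular.

(** * One power series for all slices, and the representation formula *)

Section PowerSeries.
Variables (R : realType) (f : quat R -> quat R).
Hypothesis fB : forall q, unit_ball R q -> unit_ball R (f q).
Hypothesis freg : slice_regular (unit_ball R) f.
Implicit Types (I J : quat R) (p w : R * R).

Let fholo I (I2 : imag_units R I) p : `|slice_pt I p| < 1 -> holomorphic_at I (f \o slice_pt I) p.
Proof. exact: slice_regular_holo. Qed.

Let fbound I p : `|slice_pt I p| < 1 -> `|(f \o slice_pt I) p| <= 1.
Proof. by move=> p1; apply: ltW; exact: fB. Qed.

Lemma slice_taylor_cvg I w : imag_units R I -> `|slice_pt I w| < 1 ->
  (fun n => \sum_(k < n) slice_pt I w ^+ k * taylor_coef I (f \o slice_pt I) k) @ \oo
  --> f (slice_pt I w).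
Proof.
move=> I2 w1; have [C [rho [rho0 rho1 est]]] :=
  taylor_estimate I2 (fholo I2) w1 (@fbound I).
apply/cvgrPdist_le => e e0.
have := @cvg_geometric R C rho; rewrite ger0_norm // => /(_ rho1).
move=> /cvgrPdist_le /(_ e e0) [n _ nP]; exists n.+1 => // -[//|m] /= nm.
have := nP m.+1 (ltnW nm); rewrite /= sub0r normrN => le.
exact: le_trans (est m) (le_trans (ler_norm _) le).
Qed.

Lemma slice_taylor_bound I k : imag_units R I ->
  `|taylor_coef I (f \o slice_pt I) k| <= 4 * expR 1 ^+ k.
Proof.
move=> I2; have p20 : 0 < pi *+ 2 :> R by rewrite mulrn_wgt0 // pi_gt0.
rewrite /taylor_coef normrZ ger0_norm; last by rewrite invr_ge0 ltW.
rewrite mulrC ler_pdivrMr //.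
have N10 : (-1 : R) < 0 by rewrite oppr_lt0.
apply: le_trans (qint_norm_le (e := expR 1 ^+ k) _ _ _) _.
- apply: (continuous_circle (F := fun q => qinv (slice_pt I q) ^+ k * (f \o slice_pt I) q)) => t.
  apply: (@holo_continuous _ I); apply: holo_mulXV => //; first exact: (polar_neq0 I2).
  by apply: fholo => //; exact: polar_in_disc.
- exact: ltW.
- move=> t _; rewrite qnormM qnormX qnorm_inv slice_pt_polar_norm //= expRN invrK.
  by rewrite ler_piMr ?exprn_ge0 ?expR_ge0 //; apply: fbound; exact: polar_in_disc.
- by rewrite subr0 mulrAC.
Qed.

Lemma real_slice_pt I (x : R) : slice_pt I (x, 0) = x%:A.
Proof. by rewrite /slice_pt /= scale0r addr0. Qed.

Lemma real_expr (x : R) k : (x%:A : quat R) ^+ k = (x ^+ k)%:A.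
Proof. by rewrite exprZn expr1n. Qed.

Lemma taylor_coef_slice I J k : imag_units R I -> imag_units R J ->
  taylor_coef I (f \o slice_pt I) k = taylor_coef J (f \o slice_pt J) k.
Proof.
move=> I2 J2; apply/eqP; rewrite -subr_eq0; apply/eqP.
apply: (@power_series_zero R (fun k => taylor_coef I (f \o slice_pt I) k -
   taylor_coef J (f \o slice_pt J) k) (expR 1) 8).
- by rewrite ltW // expR_gt1.
- by [].
- move=> j; apply: le_trans (ler_normB _ _) _.
  apply: le_trans (lerD (slice_taylor_bound j I2) (slice_taylor_bound j J2)) _.
  by rewrite -mulrDl (_ : 4 + 4 = 8 :> R) //; ring.
- move=> x /andP[x0 x1].
  have xI K : imag_units R K -> (fun n => \sum_(k < n) x ^+ k *:
      taylor_coef K (f \o slice_pt K) k) @ \oo --> f x%:A.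
    move=> K2; have := @slice_taylor_cvg K (x, 0) K2.
    rewrite real_slice_pt normrZ qnorm1 mulr1 gtr0_norm // => /(_ x1).
    rewrite (_ : (fun n => _) = (fun n => \sum_(k < n) x ^+ k *:
      taylor_coef K (f \o slice_pt K) k)) //.
    apply/funext => n; apply: eq_bigr => j _.
    by rewrite real_expr -scalerAl mul1r.
  rewrite [X in X @ _ --> _](_ : _ = (fun n =>
     \sum_(k < n) x ^+ k *: taylor_coef I (f \o slice_pt I) k -
     \sum_(k < n) x ^+ k *: taylor_coef J (f \o slice_pt J) k)).
    have := cvgB (xI I I2) (xI J J2); rewrite (subrr (f x%:A)); apply.
  by apply/funext => n; rewrite -sumrB; apply: eq_bigr => j _; rewrite scalerBr.
Qed.

Definition quat_i : quat R := Quat 0 1 0 0.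

Lemma quat_i_unit : imag_units R quat_i.
Proof. by rewrite /imag_units /= expr2 !quatE; congr Quat => /=; ring. Qed.

Definition coef k := taylor_coef quat_i (f \o slice_pt quat_i) k.

Lemma slice_coefE I k : imag_units R I -> taylor_coef I (f \o slice_pt I) k = coef k.
Proof. by move=> I2; apply: taylor_coef_slice => //; exact: quat_i_unit. Qed.

Lemma quat_in_slice (q : quat R) : exists I w, imag_units R I /\ q = slice_pt I w.
Proof.
pose m := Num.sqrt (qi q ^+ 2 + qj q ^+ 2 + qk q ^+ 2).
have m2 : m ^+ 2 = qi q ^+ 2 + qj q ^+ 2 + qk q ^+ 2.
  by rewrite sqr_sqrtr // !addr_ge0 ?sqr_ge0.
have [m0|m0] := eqVneq m 0.
  exists quat_i, (qre q, 0); split; first exact: quat_i_unit.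
  move: m2; rewrite m0 expr0n /= => /eqP.
  rewrite eq_sym !paddr_eq0 ?addr_ge0 ?sqr_ge0 // !sqrf_eq0.
  move=> /andP[/andP[/eqP q1 /eqP q2] /eqP q3].
  by apply: quat_ext; rewrite /slice_pt !quatE /= ?q1 ?q2 ?q3; ring.
exists (Quat 0 (qi q / m) (qj q / m) (qk q / m)), (qre q, m); split.
  rewrite /imag_units /= expr2 !quatE; congr Quat => /=; try ring.
  rewrite (_ : _ - _ = - ((qi q ^+ 2 + qj q ^+ 2 + qk q ^+ 2) / m ^+ 2)); last by field.
  by rewrite -m2 divff // expf_neq0.
by apply: quat_ext; rewrite /slice_pt !quatE /=; field.
Qed.

Lemma power_series_cvg (q : quat R) : `|q| < 1 ->
  (fun n => \sum_(k < n) q ^+ k * coef k) @ \oo --> f q.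
Proof.
have [I [w [I2 ->]]] := quat_in_slice q => w1.
have := slice_taylor_cvg I2 w1.
rewrite (_ : (fun n => _) = (fun n => \sum_(k < n) slice_pt I w ^+ k * coef k)) //.
by apply/funext => n; apply: eq_bigr => j _; rewrite slice_coefE.
Qed.

(* The real coordinates of the k-th power of x + I y, which do not depend on I. *)
Fixpoint slice_pow p k : R * R := if k is k'.+1 then
  let q := slice_pow p k' in (p.1 * q.1 - p.2 * q.2, p.1 * q.2 + p.2 * q.1) else (1, 0).

Lemma slice_powE I p k : imag_units R I -> slice_pt I p ^+ k = slice_pt I (slice_pow p k).
Proof.
move=> I2; elim: k => [|k IH]; first by rewrite expr0 /slice_pt /= scale1r scale0r addr0.
rewrite exprS IH /=; move: (slice_pow p k) => q; rewrite /slice_pt /=.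
rewrite mulrDl !mulrDr -!scalerAl -!scalerAr !mul1r !mulr1 imag_unit_mul //.
apply: quat_ext; rewrite !quatE /=; ring.
Qed.

(** The partial sums have the form [u n + I * v n] with [u] and [v] independent of [I]. Convergence
    at the two units [quat_i] and [- quat_i] gives that of [u] and [v] separately, by half sum and
    half difference, and this settles every other unit. *)
Lemma slice_representation p : `|slice_pt quat_i p| < 1 ->
  exists b c, forall I, imag_units R I -> f (slice_pt I p) = b + I * c.
Proof.
move=> p1.
pose u n := \sum_(k < n) (slice_pow p k).1 *: coef k.
pose v n := \sum_(k < n) (slice_pow p k).2 *: coef k.
have partial I n : imag_units R I -> \sum_(k < n) slice_pt I p ^+ k * coef k = u n + I * v n.
  move=> I2; rewrite /u /v mulr_sumr -big_split /=; apply: eq_bigr => k _.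
  by rewrite slice_powE // /slice_pt mulrDl -!scalerAl mul1r scalerAr.
have cv I : imag_units R I -> (fun n => u n + I * v n) @ \oo --> f (slice_pt I p).
  move=> I2; rewrite -(_ : (fun n => \sum_(k < n) slice_pt I p ^+ k * coef k) = (fun n => u n + I * v n)).
    apply: power_series_cvg.
    have -> : `|slice_pt I p| = `|slice_pt quat_i p| :> R.
      apply/eqP; rewrite -(@eqrXn2 _ 2) //; apply/eqP.
      by rewrite !slice_pt_norm2 //; exact: quat_i_unit.
    exact: p1.
  by apply/funext => n; exact: partial.
have Ni : imag_units R (- quat_i) by rewrite /imag_units /= sqrrN; exact: quat_i_unit.
have ci := cv _ quat_i_unit; have cNi := cv _ Ni.
pose b := 2^-1 *: (f (slice_pt quat_i p) + f (slice_pt (- quat_i) p)).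
pose c := 2^-1 *: (- quat_i * (f (slice_pt quat_i p) - f (slice_pt (- quat_i) p))).
have ub : u @ \oo --> b.
  rewrite (_ : u = fun n => 2^-1 *: ((u n + quat_i * v n) + (u n + - quat_i * v n))).
    by apply: cvgZ; [exact: cvg_cst|exact: cvgD ci cNi].
  apply/funext => n; move: (u n) (v n) => x y.
  by apply: quat_ext; rewrite !quatE /=; field.
have cml (w : quat R) (g : nat -> quat R) (l : quat R) : g @ \oo --> l -> (fun n => w * g n) @ \oo --> w * l.
  move=> gl; have cw : {for l, continuous (fun x : quat R => w * x)}.
    by apply: (@continuous_qmul _ _ (fun=> w) id); [exact: cst_continuous|exact: cvg_id].
  exact: (cvg_comp _ _ gl cw).
have vc : v @ \oo --> c.
  rewrite (_ : v = fun n => 2^-1 *: (- quat_i * ((u n + quat_i * v n) - (u n + - quat_i * v n)))).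
    by apply: cvgZ; [exact: cvg_cst|apply: cml; exact: cvgB ci cNi].
  apply/funext => n; move: (u n) (v n) => x y.
  by apply: quat_ext; rewrite !quatE /=; field.
exists b, c => I I2; apply: (cvg_unique (@norm_hausdorff _ _) (cv I I2)).
by apply: cvgD => //; exact: cml.
Qed.

End PowerSeries.

Lemma mul_qVqX (R : realType) (q : quat R) k : q != 0 -> qinv q ^+ k * q ^+ k = 1.
Proof.
move=> q0; elim: k => [|k IH]; first by rewrite !expr0 mulr1.
by rewrite exprSr exprS -mulrA [qinv _ * _]mulrA mul_qVq // mul1r.
Qed.

(** * The inequality at a pair of conjugate points *)

Section InnerProduct.
Variable R : realType.
Implicit Types (p q A B b c : quat R).

Lemma qdotC p q : qdot p q = qdot q p. Proof. by rewrite /qdot; ring. Qed.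
Lemma qdotDl p q r : qdot (p + q) r = qdot p r + qdot q r.
Proof. by rewrite /qdot !quatE /=; ring. Qed.
Lemma qdotZr a p q : qdot p (a *: q) = a * qdot p q.
Proof. by rewrite /qdot !quatE /=; ring. Qed.
Lemma qdot0l q : qdot 0 q = 0. Proof. by rewrite /qdot !quatE /=; ring. Qed.
Lemma qdot_mull p q r : qdot (p * q) r = qdot q (qconj p * r).
Proof. by rewrite /qdot /qconj !quatE /=; ring. Qed.

Lemma qnorm2D p q : `|p + q| ^+ 2 = `|p| ^+ 2 + 2 * qdot p q + `|q| ^+ 2.
Proof. by rewrite !qnorm2 /qdot !quatE /=; ring. Qed.
Lemma qnorm2B p q : `|p - q| ^+ 2 = `|p| ^+ 2 - 2 * qdot p q + `|q| ^+ 2.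
Proof. by rewrite !qnorm2 /qdot !quatE /=; ring. Qed.

Lemma qdot_le p q : qdot p q <= `|p| * `|q|.
Proof.
rewrite -(ler_pM2l (ltr0Sn R 1)) -(lerD2l (`|p| ^+ 2)) -(lerD2r (`|q| ^+ 2)).
rewrite -qnorm2D [leRHS](_ : _ = (`|p| + `|q|) ^+ 2); last by ring.
by rewrite ler_pXn2r ?nnegrE ?addr_ge0 // ler_normD.
Qed.

(** The Gram determinant of [b] and [c], which is also the squared norm of the imaginary part of
    [qconj b * c]. *)
Definition gram b c := qdot b b * qdot c c - qdot b c ^+ 2.

(** The products of [c] with 1, i, j, k are orthogonal and of norm |c|; expanding [b] along them is
    Euler's four square identity. *)
Lemma gramE b c :
  gram b c = qdot b (Quat 0 1 0 0 * c) ^+ 2 + qdot b (Quat 0 0 1 0 * c) ^+ 2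
    + qdot b (Quat 0 0 0 1 * c) ^+ 2.
Proof. by rewrite /gram /qdot !quatE /=; ring. Qed.

(** The left side is a linear form in the three coordinates of [I], which range over the unit
    sphere. Its maximum is the length of its coefficient vector, attained at the normalised vector;
    if that vector is 0, any unit serves. *)
Lemma max_imag_unit b c : exists2 I, imag_units R I &
  qdot b (I * c) = Num.sqrt (gram b c).
Proof.
have := gramE b c; set x := qdot _ _; set y := qdot _ _; set v := qdot _ _ => G.
have lin i j k : qdot b (Quat 0 i j k * c) = i * x + j * y + k * v.
  by rewrite /x /y /v /qdot !quatE /=; ring.
have imag i j k : i ^+ 2 + j ^+ 2 + k ^+ 2 = 1 -> imag_units R (Quat 0 i j k).
  move=> E; rewrite /imag_units /= expr2 !quatE; congr Quat => /=; try ring.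
  by rewrite -E; ring.
have n2 : Num.sqrt (gram b c) ^+ 2 = gram b c.
  by rewrite sqr_sqrtr // G !addr_ge0 ?sqr_ge0.
have [n0|n0] := eqVneq (Num.sqrt (gram b c)) 0.
  exists (Quat 0 1 0 0); first by apply: imag; ring.
  rewrite n0 -/x; apply/eqP; rewrite -sqrf_eq0; move: n2; rewrite n0 expr0n /= G => /esym/eqP.
  by rewrite !paddr_eq0 ?addr_ge0 ?sqr_ge0 // => /andP[/andP[]].
set n := Num.sqrt _ in n2 n0 *; exists (Quat 0 (x / n) (y / n) (v / n)).
  by apply: imag; rewrite !expr_div_n -!mulrDl -G -n2 divff // expf_neq0.
by rewrite lin; apply: (mulfI n0); rewrite -[RHS]expr2 n2 G; field.
Qed.

(* With X + I Y the slice decomposition, (A, B) -> (b A - c B, b B + c A) is left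
   multiplication by b + I c. *)
Lemma slice_mul_contractive b c A B :
  (forall I, imag_units R I -> `|b + I * c| <= 1) ->
  `|b * A - c * B| ^+ 2 + `|b * B + c * A| ^+ 2 <= `|A| ^+ 2 + `|B| ^+ 2.
Proof.
move=> le1; have [I I2 E] := max_imag_unit b c.
(* The hypothesis is used only at the unit that makes |b + I c| largest. *)
have S1 : `|b| ^+ 2 + `|c| ^+ 2 + 2 * Num.sqrt (gram b c) <= 1.
  have : `|b + I * c| ^+ 2 <= 1 by rewrite expr_le1 // le1.
  rewrite qnorm2D E qnormM (imag_unit_norm I2) mul1r; lra.
pose U : quat R := Quat 0 (qi (qconj b * c)) (qj (qconj b * c)) (qk (qconj b * c)).
have U2 : `|U| = Num.sqrt (gram b c).
  rewrite -[LHS]ger0_norm // -sqrtr_sqr; congr Num.sqrt.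
  by rewrite qnorm2 /U /gram /qconj /qdot !quatE /=; ring.
(* The cross terms combine into [4 * qdot B (U * A)] with [U] the imaginary part of [qconj b * c].
   By Cauchy-Schwarz and 2xy <= x^2 + y^2 they are absorbed by the term [2 * Num.sqrt (gram b c)] of
   [S1]. *)
have -> : `|b * A - c * B| ^+ 2 + `|b * B + c * A| ^+ 2 =
    (`|b| ^+ 2 + `|c| ^+ 2) * (`|A| ^+ 2 + `|B| ^+ 2) + 4 * qdot B (U * A).
  by rewrite !qnorm2 /U /qconj /qdot !quatE /=; ring.
have := qdot_le B (U * A); rewrite qnormM U2.
move: (Num.sqrt (gram b c)) (sqrtr_ge0 (gram b c)) S1 (qdot _ _) => n n0 S1 d.
move: `|A| `|B| (normr_ge0 A) (normr_ge0 B) (`|b| ^+ 2 + `|c| ^+ 2) S1 => x y x0 y0 S S1 dle.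
have h1 : 0 <= n * (x - y) ^+ 2 by rewrite mulr_ge0 // sqr_ge0.
have h2 : 0 <= (1 - (S + 2 * n)) * (x ^+ 2 + y ^+ 2).
  by apply: mulr_ge0; [rewrite subr_ge0|rewrite addr_ge0 ?sqr_ge0].
nra.
Qed.

End InnerProduct.

(** * Parseval's identity and Bessel's inequality on circles *)

Section Parseval.
Variables (R : realType) (I : quat R).
Hypothesis I2 : imag_units R I.
Local Notation z := (slice_pt I).
Implicit Types (s t : R) (K : R * R -> quat R).

Lemma circ_power_ortho n m s : s < 0 ->
  circle_int (fun q => qinv (z q) ^+ n * z q ^+ m) s = if n == m then (pi *+ 2)%:A else 0.
Proof.
move=> s0; have z0 t : z (polar (s, t)) != 0 by rewrite slice_pt_eq0 // (polar_neq0 I2).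
have cancel k t := mul_qVqX k (z0 t).
case: ltngtP => [nm|mn|->].
- have -> : m = (n + (m - n).-1.+1)%N by rewrite prednK ?subn_gt0 // subnKC // ltnW.
  transitivity (circle_int (fun q => z q ^+ (m - n).-1.+1 * 1) s).
    by apply: eq_qint => t _; rewrite exprD mulrA cancel mul1r mulr1.
  by apply: (@circ_positive_power _ _ (fun=> 1)) => // p _; exact: holo_cst.
- have -> : n = ((n - m).-1.+1 + m)%N by rewrite prednK ?subn_gt0 // subnK // ltnW.
  transitivity (circle_int (fun q => qinv (z q) ^+ (n - m).-1.+1) s).
    by apply: eq_qint => t _; rewrite exprD -mulrA cancel mulr1.
  exact: circ_negative_power.
- transitivity (circle_int (fun=> 1 : quat R) s); last by rewrite circ_cst.
  by apply: eq_qint => t _; rewrite cancel.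
Qed.

(** Turns the adjoint of multiplication by a power into a negative power, and is the source of the
    weights [(expR s ^+ 2) ^+ n]. *)
Lemma qconj_polar s t :
  qconj (z (polar (s, t))) = (expR s ^+ 2) *: qinv (z (polar (s, t))).
Proof.
rewrite /qinv slice_pt_polar_norm //= scalerA divff ?scale1r //.
by rewrite expf_neq0 // gt_eqF // expR_gt0.
Qed.

Lemma qconjX (q : quat R) n : qconj (q ^+ n) = qconj q ^+ n.
Proof.
elim: n => [|n IH]; first by rewrite !expr0; apply: quat_ext; rewrite /qconj !quatE /=; ring.
rewrite exprSr exprS -IH; move: (q ^+ n) => p.
by apply: quat_ext; rewrite /qconj !quatE /=; ring.
Qed.

Lemma continuous_inv_power n s : continuous (fun t => qinv (z (polar (s, t))) ^+ n).
Proof.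
apply: (continuous_circle (F := fun q => qinv (z q) ^+ n)) => t.
have := @holo_mulXV _ _ I2 (fun=> 1) n _ (polar_neq0 I2 (s, t)) (holo_cst _ _ _).
move=> /holo_continuous; rewrite (_ : (fun q => _) = fun q => qinv (z q) ^+ n) //.
by apply/funext => q; rewrite mulr1.
Qed.

Lemma continuous_power n s : continuous (fun t => z (polar (s, t)) ^+ n).
Proof.
apply: (continuous_circle (F := fun q => z q ^+ n)) => t.
have := @holo_mulX _ I (fun=> 1) n (polar (s, t)) (holo_cst _ _ _).
move=> /holo_continuous; rewrite (_ : (fun q => _) = fun q => z q ^+ n) //.
by apply/funext => q; rewrite mulr1.
Qed.

Lemma continuous_qmul2 (F G : R -> quat R) : continuous F -> continuous G ->
  continuous (fun t => F t * G t).
Proof. by move=> cF cG t; apply: continuous_qmul; [exact: cF|exact: cG]. Qed.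

Lemma continuous_qdot (F G : R -> quat R) : continuous F -> continuous G ->
  continuous (fun t => qdot (F t) (G t)).
Proof.
move=> cF cG t; apply: cvgD; [apply: cvgD; [apply: cvgD|]|]; apply: cvgM;
  by [exact: (cqre cF)|exact: (cqi cF)|exact: (cqj cF)|exact: (cqk cF)|
   exact: (cqre cG)|exact: (cqi cG)|exact: (cqj cG)|exact: (cqk cG)].
Qed.

Definition slice_poly N (c : nat -> quat R) (q : R * R) : quat R :=
  \sum_(n < N) z q ^+ n * c n.

Lemma continuous_slice_poly N c s : continuous (fun t => slice_poly N c (polar (s, t))).
Proof.
apply: continuous_qsum => n; apply: continuous_qmul2; first exact: continuous_power.
exact: cst_continuous.
Qed.

(** Moving z^n to the other side of the real inner product makes it conj(z)^n = r^(2n) z^(-n), where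
    r is the radius; what remains of [K] is its n-th coefficient. *)
Lemma rint_slice_poly_dot N c s K : continuous (fun t => K (polar (s, t))) ->
  rint 0 (pi *+ 2) (fun t => qdot (slice_poly N c (polar (s, t))) (K (polar (s, t)))) =
  \sum_(n < N) (expR s ^+ 2) ^+ n * qdot (c n) (circle_int (fun q => qinv (z q) ^+ n * K q) s).
Proof.
move=> cK.
have cVK n : continuous (fun t => qinv (z (polar (s, t))) ^+ n * K (polar (s, t))).
  by apply: continuous_qmul2 => //; exact: continuous_inv_power.
elim: N => [|N IH].
  rewrite big_ord0; transitivity (rint 0 (pi *+ 2) (fun=> 0 : R)).
    by apply: eq_rint => t _; rewrite /slice_poly big_ord0 qdot0l.
  by rewrite rint_cst ?mul0r // mulrn_wge0 // pi_ge0.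
rewrite big_ord_recr /= -IH -rint_qdot // -rintZ; last first.
  by apply: continuous_qdot => //; exact: cst_continuous.
rewrite -rintD; first last.
- move=> t; apply: cvgM; first exact: cvg_cst.
  by apply: continuous_qdot => //; exact: cst_continuous.
- by apply: continuous_qdot => //; exact: continuous_slice_poly.
apply: eq_rint => t _; rewrite /slice_poly big_ord_recr /= qdotDl; congr (_ + _).
rewrite qdot_mull qconjX qconj_polar exprZn -scalerAl qdotZr //.
Qed.

Lemma parseval N c s : s < 0 ->
  rint 0 (pi *+ 2) (fun t => `|slice_poly N c (polar (s, t))| ^+ 2) =
  (pi *+ 2) * \sum_(n < N) (expR s ^+ 2) ^+ n * `|c n| ^+ 2.
Proof.
move=> s0; have cP := @continuous_slice_poly N c s.
transitivity (rint 0 (pi *+ 2)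
   (fun t => qdot (slice_poly N c (polar (s, t))) (slice_poly N c (polar (s, t))))).
  by apply: eq_rint => t _; rewrite qnorm2.
rewrite rint_slice_poly_dot // mulr_sumr; apply: eq_bigr => n _.
have -> : circle_int (fun q => qinv (z q) ^+ n * slice_poly N c q) s = (pi *+ 2) *: c n.
  transitivity (qint 0 (pi *+ 2) (fun t => \sum_(m < N)
      qinv (z (polar (s, t))) ^+ n * z (polar (s, t)) ^+ m * c m)).
    by apply: eq_qint => t _; rewrite /slice_poly mulr_sumr; apply: eq_bigr => m _; rewrite mulrA.
  have cVz m : continuous (fun t => qinv (z (polar (s, t))) ^+ n * z (polar (s, t)) ^+ m).
    by apply: continuous_qmul2; [exact: continuous_inv_power|exact: continuous_power].
  rewrite qint_sum; last first.
    by move=> m; apply: continuous_qmul2 => //; exact: cst_continuous.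
  rewrite (bigD1 n) //= big1 ?addr0; last first.
    move=> m mn; rewrite qint_mulr // -/(circle_int (fun q => qinv (z q) ^+ n * z q ^+ m) s).
    rewrite circ_power_ortho // ifF ?mul0r //; apply/negbTE; apply: contra mn.
    by rewrite eq_sym => /eqP/val_inj ->.
  rewrite qint_mulr // -/(circle_int (fun q => qinv (z q) ^+ n * z q ^+ n) s).
  by rewrite circ_power_ortho // eqxx -scalerAl mul1r.
by rewrite qdotZr -qnorm2; ring.
Qed.

(** Integrate 0 <= |P - K|^2 with P the truncated series of [K]: the pairing of P with [K] equals
    the squared norm of P. *)
Lemma bessel N c s K : s < 0 -> continuous (fun t => K (polar (s, t))) ->
  (forall n, circle_int (fun q => qinv (z q) ^+ n * K q) s = (pi *+ 2) *: c n) ->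
  (pi *+ 2) * \sum_(n < N) (expR s ^+ 2) ^+ n * `|c n| ^+ 2 <=
  rint 0 (pi *+ 2) (fun t => `|K (polar (s, t))| ^+ 2).
Proof.
move=> s0 cK cn; have cP := @continuous_slice_poly N c s.
have csq (G : R -> quat R) : continuous G -> continuous (fun t => `|G t| ^+ 2).
  move=> cG; rewrite (_ : (fun t => _) = fun t => qdot (G t) (G t)).
    exact: continuous_qdot.
  by apply/funext => t; rewrite qnorm2.
have P2 := @parseval N c s s0.
have PK := @rint_slice_poly_dot N c s K cK.
set S := (pi *+ 2) * _ in P2 *.
have PKS : rint 0 (pi *+ 2) (fun t => qdot (slice_poly N c (polar (s, t))) (K (polar (s, t)))) = S.
  rewrite PK /S mulr_sumr; apply: eq_bigr => n _; rewrite cn qdotZr -qnorm2; ring.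
have E1 : rint 0 (pi *+ 2) (fun t =>
    2 * qdot (slice_poly N c (polar (s, t))) (K (polar (s, t)))) = 2 * S.
  by rewrite -PKS; exact: (rintZ 0 (pi *+ 2) 2 (continuous_qdot cP cK)).
have E2 : rint 0 (pi *+ 2) (fun t =>
    `|slice_poly N c (polar (s, t))| ^+ 2 + `|K (polar (s, t))| ^+ 2) =
    S + rint 0 (pi *+ 2) (fun t => `|K (polar (s, t))| ^+ 2).
  by rewrite -P2; exact: (rintD 0 (pi *+ 2) (csq _ cP) (csq _ cK)).
rewrite -(lerD2l S) -E2 -[X in X <= _]mulr2n -[X in X <= _]mulr_natl -E1; apply: le_rint.
- by move=> t; apply: cvgM; [exact: cvg_cst|exact: continuous_qdot].
- by move=> t; apply: cvgD; exact: csq.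
move=> t _; have := qnorm2B (slice_poly N c (polar (s, t))) (K (polar (s, t))).
have := sqr_ge0 (`|slice_poly N c (polar (s, t)) - K (polar (s, t))|); lra.
Qed.

End Parseval.

(** * Convolution with the coefficients of [f] contracts square sums *)

Section Contraction.
Variables (R : realType) (f : quat R -> quat R).
Hypothesis fB : forall q, unit_ball R q -> unit_ball R (f q).
Hypothesis freg : slice_regular (unit_ball R) f.
Implicit Types (I : quat R) (h : nat -> quat R) (p q : R * R) (s t : R).

(* Coefficients of the regular product of [f] with the polynomial of coefficients [h]. *)
Definition star_coef M h n : quat R := \sum_(m < M | (m <= n)%N) coef f (n - m) * h m.

(** The regular product keeps powers of the variable on the left of all coefficients, so z^m
    precedes the value of [f], with which it need not commute. *)
Definition star_poly I M h q : quat R :=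
  \sum_(m < M) slice_pt I q ^+ m * (f (slice_pt I q) * h m).

Lemma continuous_f_circle I s : imag_units R I -> s < 0 ->
  continuous (fun t => f (slice_pt I (polar (s, t)))).
Proof.
move=> I2 s0; apply: (continuous_circle (F := f \o slice_pt I)) => t.
apply: (@holo_continuous _ I); apply: slice_regular_holo => //.
exact: polar_in_disc.
Qed.

Lemma circ_shift I n m s : imag_units R I -> s < 0 ->
  circle_int (fun q => qinv (slice_pt I q) ^+ n * (slice_pt I q ^+ m * f (slice_pt I q))) s =
  if (m <= n)%N then (pi *+ 2) *: coef f (n - m) else 0.
Proof.
move=> I2 s0; have z0 t : slice_pt I (polar (s, t)) != 0.
  by rewrite slice_pt_eq0 // (polar_neq0 I2).
have hF p : `|slice_pt I p| < 1 -> holomorphic_at I (f \o slice_pt I) p.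
  exact: slice_regular_holo.
have cancel k t := mul_qVqX k (z0 t).
case: leqP => [mn|nm].
  rewrite -(slice_coefE fB freg _ I2) -(circ_taylor_coef I2 hF _ s0).
  apply: eq_qint => t _; rewrite /= -{1}(subnK mn) exprD mulrA -[_ * _ * _ ^+ m]mulrA.
  by rewrite cancel mulr1.
rewrite -[RHS](circ_positive_power I2 hF (m - n).-1 s0).
apply: eq_qint => t _; rewrite /= prednK ?subn_gt0 // -{1}(subnKC (ltnW nm)) exprD.
by rewrite -mulrA mulrA cancel mul1r.
Qed.

Lemma continuous_star_poly I M h s : imag_units R I -> s < 0 ->
  continuous (fun t => star_poly I M h (polar (s, t))).
Proof.
move=> I2 s0; apply: continuous_qsum => m; apply: continuous_qmul2.
  exact: continuous_power.
by apply: continuous_qmul2; [exact: continuous_f_circle|exact: cst_continuous].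
Qed.

Lemma circ_star_poly I M h n s : imag_units R I -> s < 0 ->
  circle_int (fun q => qinv (slice_pt I q) ^+ n * star_poly I M h q) s =
  (pi *+ 2) *: star_coef M h n.
Proof.
move=> I2 s0; transitivity (qint 0 (pi *+ 2) (fun t => \sum_(m < M)
   qinv (slice_pt I (polar (s, t))) ^+ n * (slice_pt I (polar (s, t)) ^+ m *
     f (slice_pt I (polar (s, t)))) * h m)).
  apply: eq_qint => t _; rewrite /star_poly mulr_sumr; apply: eq_bigr => m _.
  by rewrite !mulrA.
have c m : continuous (fun t => qinv (slice_pt I (polar (s, t))) ^+ n *
    (slice_pt I (polar (s, t)) ^+ m * f (slice_pt I (polar (s, t))))).
  apply: continuous_qmul2; first exact: continuous_inv_power.
  by apply: continuous_qmul2; [exact: continuous_power|exact: continuous_f_circle].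
rewrite qint_sum; last first.
  by move=> m; apply: continuous_qmul2; [exact: c|exact: cst_continuous].
rewrite /star_coef scaler_sumr [RHS]big_mkcond /=; apply: eq_bigr => m _.
rewrite qint_mulr; last exact: c.
have := @circ_shift I n m s I2 s0; rewrite /circle_int => ->.
by case: ifP => _; rewrite ?mul0r // scalerAl.
Qed.

Lemma imag_unitN I : imag_units R I -> imag_units R (- I).
Proof. by rewrite /imag_units /= sqrrN. Qed.

Lemma norm2DB (x y : quat R) : `|x + y| ^+ 2 + `|x - y| ^+ 2 = 2 * (`|x| ^+ 2 + `|y| ^+ 2).
Proof. by rewrite qnorm2D qnorm2B; ring. Qed.

(** Write h as A + I B and the value of [f] as b + I c, with A, B, b, c independent of [I]. By the
    parallelogram law the sum over [I] and [- I] is 2 (|A|^2 + |B|^2), free of mixed terms, and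
    [slice_mul_contractive] applies. *)
Lemma star_poly_pointwise I M h q : imag_units R I -> `|slice_pt I q| < 1 ->
  `|star_poly I M h q| ^+ 2 + `|star_poly (- I) M h q| ^+ 2 <=
  `|slice_poly I M h q| ^+ 2 + `|slice_poly (- I) M h q| ^+ 2.
Proof.
move=> I2 q1; have norm_eq J : imag_units R J -> `|slice_pt J q| = `|slice_pt I q|.
  by move=> J2; apply/eqP; rewrite -(@eqrXn2 _ 2) //; apply/eqP; rewrite !slice_pt_norm2.
have q1i : `|slice_pt (quat_i R) q| < 1 by rewrite norm_eq //; exact: quat_i_unit.
have [b [c fE]] := slice_representation fB freg q1i.
have le1 J : imag_units R J -> `|b + J * c| <= 1.
  by move=> J2; rewrite -fE // ltW //; apply: fB; rewrite /unit_ball /= norm_eq.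
pose A := \sum_(m < M) (slice_pow q m).1 *: h m.
pose B := \sum_(m < M) (slice_pow q m).2 *: h m.
have hE J : imag_units R J -> slice_poly J M h q = A + J * B.
  move=> J2; rewrite /slice_poly /A /B mulr_sumr -big_split /=; apply: eq_bigr => m _.
  by rewrite slice_powE // /slice_pt mulrDl -!scalerAl mul1r scalerAr.
have gE J : imag_units R J -> star_poly J M h q = (b * A - c * B) + J * (b * B + c * A).
  move=> J2; rewrite /star_poly fE // /A /B !mulr_sumr -sumrB -big_split mulr_sumr -big_split /=.
  apply: eq_bigr => m _; rewrite slice_powE // /slice_pt; move: (slice_pow q m) (h m) => [x y] v /=.
  rewrite !mulrDl !mulrDr -!scalerAl -!scalerAr !mul1r.
  have -> : J * (J * c * v) = - (c * v) by rewrite !mulrA imag_unit_mul // mulN1r mulNr.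
  rewrite scalerN -!mulrA [X in _ + _ + X]addrC addrACA; congr (_ + _); exact: addrC.
rewrite (hE _ I2) (hE _ (imag_unitN I2)) (gE _ I2) (gE _ (imag_unitN I2)) !mulNr !norm2DB.
rewrite !qnormM !(imag_unit_norm I2) !mul1r ler_pM2l //.
exact: slice_mul_contractive.
Qed.

(** The pointwise inequality is integrated on the circle for the units [quat_i] and [- quat_i],
    which have the same coefficients; hence a factor 2 on both sides. Bessel suffices for the
    product, so its series need not be summed, and Parseval evaluates the polynomial side, whose
    weights are at most 1. *)
Lemma star_coef_weighted_le N M h s : s < 0 ->
  \sum_(n < N) (expR s ^+ 2) ^+ n * `|star_coef M h n| ^+ 2 <= \sum_(m < M) `|h m| ^+ 2.
Proof.
move=> s0; have i2 := quat_i_unit R; have Ni2 := imag_unitN i2.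
have p20 : 0 < pi *+ 2 :> R by rewrite mulrn_wgt0 // pi_gt0.
have csq (G : R -> quat R) : continuous G -> continuous (fun t => `|G t| ^+ 2).
  move=> cG; rewrite (_ : (fun t => _) = fun t => qdot (G t) (G t)).
    exact: continuous_qdot.
  by apply/funext => t; rewrite qnorm2.
have cS I (I2 : imag_units R I) := csq _ (@continuous_star_poly I M h s I2 s0).
have cP I (I2 : imag_units R I) := csq _ (@continuous_slice_poly R I M h s).
have B I (I2 : imag_units R I) := @bessel R I I2 N (star_coef M h) s (star_poly I M h) s0
  (@continuous_star_poly I M h s I2 s0) (fun n => circ_star_poly M h n I2 s0).
have P I (I2 : imag_units R I) := @parseval R I I2 M h s s0.
have le1 := lerD (B _ i2) (B _ Ni2).
rewrite -(rintD 0 (pi *+ 2) (cS _ i2) (cS _ Ni2)) in le1.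
have le2 : rint 0 (pi *+ 2) (fun t => `|star_poly (quat_i R) M h (polar (s, t))| ^+ 2 +
     `|star_poly (- quat_i R) M h (polar (s, t))| ^+ 2) <=
   rint 0 (pi *+ 2) (fun t => `|slice_poly (quat_i R) M h (polar (s, t))| ^+ 2 +
     `|slice_poly (- quat_i R) M h (polar (s, t))| ^+ 2).
  apply: le_rint.
  - by move=> t; apply: cvgD; [exact: cS i2 t|exact: cS Ni2 t].
  - by move=> t; apply: cvgD; [exact: cP i2 t|exact: cP Ni2 t].
  by move=> t _; apply: star_poly_pointwise => //; exact: polar_in_disc.
rewrite (rintD 0 (pi *+ 2) (cP _ i2) (cP _ Ni2)) (P _ i2) (P _ Ni2) in le2.
have := le_trans le1 le2; rewrite -!mulr2n ler_pMn2r // ler_pM2l // => /le_trans; apply.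
apply: ler_sum => m _; rewrite ler_piMl ?sqr_ge0 // !exprn_ile1 ?exprn_ge0 ?expR_ge0 //.
by rewrite ltW // expR_lt1.
Qed.

Lemma star_coef_le N M h :
  \sum_(n < N) `|star_coef M h n| ^+ 2 <= \sum_(m < M) `|h m| ^+ 2.
Proof.
pose S s := \sum_(n < N) (expR s ^+ 2) ^+ n * `|star_coef M h n| ^+ 2.
have cX k : continuous (fun s : R => expR s ^+ k).
  elim: k => [|k IH] s; first by under eq_fun do rewrite expr0; exact: cst_continuous.
  under eq_fun do rewrite exprS.
  by apply: cvgM; [exact: continuous_expR|exact: IH].
have cS : continuous S.
  rewrite /S; elim: N {S} => [|N IH] x.
    by under eq_fun do rewrite big_ord0; exact: cst_continuous.
  under eq_fun do rewrite big_ord_recr /= -exprM.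
  by apply: cvgD; [exact: IH|apply: cvgM; [exact: cX|exact: cvg_cst]].
apply/ler_addgt0Pr => e e0.
(* The left side is a finite sum, continuous in [s], so the radius may tend to 1 from below. *)
have /cvgrPdist_le/(_ e e0) /near_pick_left [s s0] := cS 0.
rewrite ler_distl => /andP[_]; rewrite {1}/S.
under eq_bigr do rewrite expR0 !expr1n mul1r.
by move=> /le_trans; apply; rewrite lerD2r; exact: star_coef_weighted_le.
Qed.

End Contraction.

(** * Two fixed points determine the coefficients *)

Section TwoFixedPoints.
Variables (R : realType) (f : quat R -> quat R) (q0 q1 : quat R).
Hypothesis fB : forall q, unit_ball R q -> unit_ball R (f q).
Hypothesis freg : slice_regular (unit_ball R) f.
Hypotheses (q0B : unit_ball R q0) (q1B : unit_ball R q1).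
Hypotheses (fq0 : f q0 = q0) (fq1 : f q1 = q1) (q01 : q0 <> q1).

Let a := coef f.
Let d n : quat R := q0 ^+ n - q1 ^+ n.
(* The coefficients of the difference of the reproducing kernels at [q0] and [q1],
   divided by the variable. *)
Let h m : quat R := qconj (d m.+1).
Let u n : quat R := qconj (d n).
Let T K : R := \sum_(m < K) `|h m| ^+ 2.

Let u0 : u 0%N = 0.
Proof. by rewrite /u /d !expr0 subrr; apply: quat_ext; rewrite /qconj !quatE /=; ring. Qed.

Lemma qdot_conj (p q : quat R) : qdot (qconj p) q = qre (p * q).
Proof. by rewrite /qdot /qconj !quatE /=; ring. Qed.

(** Both points lie strictly inside the ball, so [h] is dominated by a geometric sequence. *)
Let T_bounded : exists B : R, forall K, T K <= B.
Proof.
pose r := Num.max `|q0| `|q1|; have r1 : r < 1 by rewrite gt_max q0B q1B.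
have r0 : 0 <= r by rewrite le_max normr_ge0.
exists (4 / (1 - r)) => K.
have hm m : `|h m| ^+ 2 <= 4 * r ^+ m.
  have : `|h m| <= 2 * r ^+ m.+1.
    rewrite /h qnorm_conj; apply: le_trans (ler_normB _ _) _.
    rewrite !qnormX mulr_natl mulr2n lerD // lerXn2r ?nnegrE //.
      by rewrite le_max lexx.
    by rewrite le_max lexx orbT.
  move=> le1; have le2 : `|h m| ^+ 2 <= (2 * r ^+ m.+1) ^+ 2.
    by rewrite lerXn2r ?nnegrE // mulr_ge0 // exprn_ge0.
  apply: le_trans le2 _; rewrite exprMn (_ : 2 ^+ 2 = 4 :> R); last by ring.
  rewrite ler_pM2l // -exprM; apply: ler_wiXn2l => //; first exact: ltW.
  by rewrite (leq_trans (leqnSn m)) // leq_pmulr.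
apply: (@le_trans _ _ (4 * \sum_(m < K) r ^+ m)).
  by rewrite mulr_sumr; apply: ler_sum => m _; exact: hm.
rewrite ler_pM2l // -[leRHS]div1r ler_pdivlMr ?subr_gt0 //.
have -> : (\sum_(m < K) r ^+ m) * (1 - r) = 1 - r ^+ K.
  elim: K => [|K IH]; first by rewrite big_ord0 expr0 mul0r subrr.
  by rewrite big_ord_recr /= mulrDl IH exprSr; ring.
by rewrite gerBl exprn_ge0.
Qed.

(** The contraction is proved for polynomials, while [h] is in general not finitely supported: it is
    cut at an index beyond which its square sum grows by at most [e]. *)
Let T_tail e : 0 < e -> forall n, exists2 M, (n <= M)%N & forall K, T K <= T M + e.
Proof.
move=> e0 n; have [B TB] := T_bounded.
have hs : has_sup (range T) by split; [exists (T 0), 0%N|exists B => _ [K _ <-]].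
have [_ [M _ <-] lt] := sup_adherent e0 hs.
have mono K j : T K <= T (K + j)%N.
  by rewrite /T big_split_ord /= lerDl sumr_ge0 // => i _; rewrite sqr_ge0.
exists (M + n)%N; first exact: leq_addl.
move=> K; have : T K <= sup (range T).
  by apply: ub_le_sup; [exists B => _ [j _ <-]|exists K].
by have := mono M n; lra.
Qed.

(** Here the fixed point equations enter: the sum of q^n a_(n-M) is q^M f(q), which is q^(M+1) at a
    fixed point. *)
Let single_cvg M : (fun N => \sum_(n < N) d n * (if (M <= n)%N then a (n - M) else 0)) @ \oo
  --> d M.+1.
Proof.
rewrite -(cvg_shiftn M).
rewrite (_ : (fun N => _) = fun N => q0 ^+ M * (\sum_(k < N) q0 ^+ k * a k) -
    q1 ^+ M * (\sum_(k < N) q1 ^+ k * a k)).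
  have cml (w : quat R) (g : nat -> quat R) (l : quat R) : g @ \oo --> l ->
      (fun n => w * g n) @ \oo --> w * l.
    move=> gl; have cw : {for l, continuous (fun x : quat R => w * x)}.
      by apply: (@continuous_qmul _ _ (fun=> w) id); [exact: cst_continuous|exact: cvg_id].
    exact: (cvg_comp _ _ gl cw).
  rewrite /d !exprSr; apply: cvgB; apply: cml.
    by rewrite -[X in _ --> X]fq0; exact: power_series_cvg.
  by rewrite -[X in _ --> X]fq1; exact: power_series_cvg.
apply/funext => N; rewrite addnC big_split_ord /= big1 ?add0r; last first.
  by move=> i _; rewrite leqNgt ltn_ord mulr0.
rewrite !mulr_sumr -sumrB; apply: eq_bigr => k _.
by rewrite leq_addr addKn /d !exprD mulrBl !mulrA.
Qed.

Let correlation_cvg M : (fun N => \sum_(n < N) d n * star_coef f M h n) @ \oo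
  --> \sum_(m < M) d m.+1 * h m.
Proof.
elim: M => [|M IH].
  rewrite big_ord0; rewrite (_ : (fun N => _) = fun=> 0); first exact: cvg_cst.
  by apply/funext => N; rewrite big1 // => n _; rewrite /star_coef big_ord0 mulr0.
rewrite big_ord_recr /=.
rewrite (_ : (fun N => _) = fun N => \sum_(n < N) d n * star_coef f M h n +
   (\sum_(n < N) d n * (if (M <= n)%N then a (n - M) else 0)) * h M).
  apply: cvgD => //.
  have cw : {for d M.+1, continuous (fun x : quat R => x * h M)}.
    by apply: (@continuous_qmul _ _ id (fun=> h M)); [exact: cvg_id|exact: cst_continuous].
  exact: (cvg_comp _ _ (@single_cvg M) cw).
apply/funext => N; rewrite mulr_suml -big_split /=; apply: eq_bigr => n _.
rewrite /star_coef big_mkcond big_ord_recr /= -big_mkcond /= mulrDr; congr (_ + _).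
by case: ifP => _; rewrite ?mulr0 ?mul0r // mulrA.
Qed.

Let star_coef_eq n : \sum_(m < n.+1) a (n - m) * h m = u n.
Proof.
apply/eqP; rewrite -subr_eq0 -normr_eq0 -sqrf_eq0 eq_le sqr_ge0 andbT.
apply/ler_addgt0Pr => e e0; rewrite add0r.
have e3 : 0 < e / 3 by rewrite divr_gt0.
(* Cutting [h] beyond index [n] leaves the n-th convolution coefficient unchanged. *)
have [M nM TM] := T_tail e3 n.+1.
have -> : \sum_(m < n.+1) a (n - m) * h m = star_coef f M h n.
  by rewrite /star_coef (big_ord_widen M (fun m => a (n - m) * h m) nM).
have reD (x y : quat R) : qre (x + y) = qre x + qre y by [].
have reV : (fun N => qre (\sum_(n < N) d n * star_coef f M h n)) @ \oo --> T M.
  have -> : T M = qre (\sum_(m < M) d m.+1 * h m).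
    rewrite (big_morph (@qre R) reD (erefl : qre (0 : quat R) = 0)).
    apply: eq_bigr => m _; rewrite /h mul_qconj qnorm_conj quat_scaleE /=.
    by rewrite mulr1.
  have cre : {for \sum_(m < M) d m.+1 * h m, continuous (@qre R)}.
    exact: (continuous_qre (@cvg_id _ _)).
  exact: (cvg_comp _ _ (@correlation_cvg M) cre).
have /cvgrPdist_le/(_ _ e3) [N0 _ nP] := reV.
pose N := (N0 + n)%N; have := nP N.+1 (leqW (leq_addr _ _)).
rewrite /= ler_distl => /andP[_ le1].
have le2 : `|star_coef f M h n - u n| ^+ 2 <=
    \sum_(j < N.+1) `|star_coef f M h j - u j| ^+ 2.
  have nN : (n < N.+1)%N by rewrite ltnS leq_addl.
  rewrite (bigD1 (Ordinal nN)) //= lerDl sumr_ge0 // => j _; exact: sqr_ge0.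
apply: le_trans le2 _.
(* Of the three terms, the first is at most [T M] by contraction, the pairing is at least
   [T M - e / 3], and [T N] is at most [T M + e / 3]; the total is at most [e]. *)
have -> : \sum_(j < N.+1) `|star_coef f M h j - u j| ^+ 2 =
    \sum_(j < N.+1) `|star_coef f M h j| ^+ 2 -
    2 * qre (\sum_(j < N.+1) d j * star_coef f M h j) + T N.
  (* The index shift costs nothing because [u 0] is 0. *)
  have -> : T N = \sum_(j < N.+1) `|u j| ^+ 2.
    by rewrite big_ord_recl u0 normr0 expr0n add0r.
  rewrite (big_morph (@qre R) reD (erefl : qre (0 : quat R) = 0)).
  rewrite mulr_sumr -sumrB -big_split /=; apply: eq_bigr => j _.
  by rewrite qnorm2B qdotC qdot_conj.
have := @star_coef_le R f fB freg N.+1 M h; rewrite -/(T M).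
have := TM N; move: le1; lra.
Qed.

Lemma coef_two_fixed_points k : coef f k = (k == 1%N)%:R.
Proof.
have h0 : h 0%N != 0.
  rewrite /h -normr_eq0 qnorm_conj normr_eq0 /d !expr1 subr_eq0; exact/eqP.
(* The shift of [h] is its convolution with the coefficients of the identity function. *)
have delta n : \sum_(m < n.+1) ((n - m)%N == 1%N)%:R * h m = u n.
  case: n => [|j]; first by rewrite big_ord_recl big_ord0 mul0r addr0 u0.
  rewrite big_ord_recr /= subnn mul0r addr0 big_ord_recr /= subSnn eqxx mul1r.
  rewrite big1 ?add0r // => i _; rewrite (_ : (_ == 1%N) = false) ?mul0r //.
  by rewrite subSn ?(ltnW (ltn_ord i)) // eqSS subn_eq0 leqNgt ltn_ord.
have zero n : \sum_(m < n.+1) (a (n - m) - ((n - m)%N == 1%N)%:R) * h m = 0.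
  under eq_bigr do rewrite mulrBl.
  by rewrite sumrB star_coef_eq delta subrr.
apply/eqP; rewrite -subr_eq0; apply/eqP; elim/ltn_ind: k => k IH.
(* The system is triangular: by induction only the term with [h 0], which is nonzero, survives. *)
have := zero k; rewrite big_ord_recl subn0 big1 => [|m _]; last first.
  have k0 : (0 < k)%N by exact: leq_ltn_trans (ltn_ord m).
  by rewrite IH ?mul0r // ltn_subrL k0.
rewrite addr0 => /(congr1 Num.norm)/eqP; rewrite qnormM normr0 mulf_eq0 !normr_eq0.
by rewrite (negbTE h0) orbF => /eqP.
Qed.

Lemma two_fixed_points_id q : unit_ball R q -> f q = q.
Proof.
move=> qB; have cf := power_series_cvg fB freg qB.
have cq : (fun n => \sum_(k < n) q ^+ k * coef f k) @ \oo --> q.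
  (* From two terms on, the partial sums are constantly [q]. *)
  rewrite -(cvg_shiftn 2) (_ : (fun n => _) = fun=> q); first exact: cvg_cst.
  apply/funext => n; rewrite addn2 !big_ord_recl !coef_two_fixed_points /= mulr0 add0r.
  rewrite expr1 mulr1 big1 ?addr0 // => k _.
  by rewrite coef_two_fixed_points mulr0.
exact: (cvg_unique (@norm_hausdorff _ _) cf cq).
Qed.

End TwoFixedPoints.

Theorem theorem1p8 (R : realType) (f : quat R -> quat R) (q0 : quat R)
    (fB : forall q, unit_ball R q -> unit_ball R (f q))
    (freg : slice_regular (unit_ball R) f)
    (q0B : unit_ball R q0) (fq0 : f q0 = q0) :
  (forall q, unit_ball R q -> f q = q) \/
  (forall q, unit_ball R q -> f q = q -> q = q0).
Proof.
have [[q1 [q1B fq1 ne]]|none] := pselect (exists q1, [/\ unit_ball R q1, f q1 = q1 & q1 <> q0]).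
  by left; exact: two_fixed_points_id fB freg q1B q0B fq1 fq0 ne.
right=> q qB fq; apply: contrapT => ne; apply: none; by exists q.
Qed.
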